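(* Let $E$ be a row-finite graph, $K$ a field, and $n\in\mathbb Z\setminus\{0\}$. Then the set $$\mathcal B_n=\left\{\sum_{\substack{\alpha\in F_E(c^0)\cup c^0\\ u\in c^0}}\alpha\, c_u^m\,\alpha^*\ \Big\vert\ c\in\mathcal S,\ m\in\mathbb Z,\ m\cdot l(c)=n\right\}$$ is a basis of $Z_n(L_K(E))$, the homogeneous component of degree $n$ of the center of $L_K(E)$.
   Context: A directed graph is $E=(E^0,E^1,r,s)$ with vertex set $E^0$, edge set $E^1$ and range and source maps $r,s:E^1\to E^0$; it is row-finite if $s^{-1}(v)$ is finite for all $v\in E^0$. A vertex $v$ is regular if $s^{-1}(v)$ is finite and nonempty. The Leavitt path algebra $L_K(E)$ is the $K$-algebra generated by $E^0\cup E^1\cup\{e^*: e\in E^1\}$ with relations: $vw=\delta_{v,w}v$ for $v,w\in E^0$; $s(e)e=er(e)=e$ and $r(e)e^*=e^*s(e)=e^*$ for $e\in E^1$; $e^*e'=\delta_{e,e'}r(e)$ for $e,e'\in E^1$; and $v=\sum_{s(e)=v}ee^*$ for every regular $v$. For a path $\alpha=e_1\dots e_k$ write $\alpha^*=e_k^*\dots e_1^*$; vertices are paths of length $0$, with $v^*=v$. $L_K(E)$ is $\mathbb Z$-graded, the degree $n$ component being spanned by the $\alpha\beta^*$ with $\alpha,\beta$ paths and $\mathrm{length}(\alpha)-\mathrm{length}(\beta)=n$; the center is a graded subalgebra. A cycle is a path $c=e_1\dots e_k$ ($k\ge1$) with $s(c)=r(c)$ and $s(e_i)\ne s(e_j)$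 for $i\neq j$; $c^0$ denotes its set of vertices and $l(c)=k$ its length. An exit of $c$ is an edge $e$ with $s(e)=s(e_i)$ and $e\neq e_i$ for some $i$. For $u=s(e_i)\in c^0$, $c_u$ denotes the cycle $e_i\dots e_ke_1\dots e_{i-1}$ based at $u$; for $m<0$, $c_u^m$ means $(c_u^* )^{-m}$. $\mathcal S$ is the set of cycles $c$ without exits such that there is only a finite number of paths ending at $c$ (i.e. at a vertex of $c^0$) and not containing $c$. $F_E(c^0)$ is the set of paths $e_1\dots e_k$ ($k\ge 1$) with $s(e_1)\notin c^0$, $r(e_i)\notin c^0$ for $i<k$, and $r(e_k)\in c^0$. (In the sum, terms with $r(\alpha)\ne u$ vanish. Cycles differing by a rotation give the same element of $\mathcal B_n$, which is a set.) *)

(* Defs.v *)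
From HB Require Import structures.
From mathcomp Require Import all_boot all_order all_algebra.
From mathcomp Require Import generic_quotient.
From mathcomp Require Import boolp classical_sets functions cardinality fsbigop.

Set Implicit Arguments.
Unset Strict Implicit.
Unset Printing Implicit Defensive.

Import GRing.Theory.
Local Open Scope classical_set_scope.
Local Open Scope ring_scope.
Local Open Scope quotient_scope.

Record digraph := Digraph {
  vertex : choiceType;
  edge : choiceType;
  esource : edge -> vertex;
  erange : edge -> vertex }.

Definition row_finite (E : digraph) :=
  forall v : vertex E, finite_set [set e : edge E | esource e = v].

Section Paths.
Variable E : digraph.
Implicit Types (c : seq (edge E)) (v : vertex E).

(* The pair (v, [:: e1; ...; ek]) stands for the path e1 ... ek starting at v;
   (v, [::]) is the vertex v regarded as a path of length 0. *)
Definition prepath := (vertex E * seq (edge E))%type.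
Implicit Type p : prepath.

Definition composable : rel (edge E) := fun e f => erange e == esource f.

Definition is_path p : bool :=
  sorted composable p.2 && (if p.2 is e :: _ then esource e == p.1 else true).

Definition path_range p : vertex E := last p.1 [seq erange e | e <- p.2].

(* [cycle composable c] also requires the last edge to end where the first
   one starts. *)
Definition is_cycle c : bool :=
  [&& c != [::], cycle composable c & uniq [seq esource e | e <- c]].

Definition cycle_vertices c : set (vertex E) :=
  [set u | u \in [seq esource e | e <- c]].

Definition is_exit c (e : edge E) : Prop :=
  exists2 f, f \in c & esource e = esource f /\ e <> f.

Definition cycle_at c v : seq (edge E) :=
  rot (index v [seq esource e | e <- c]) c.

Definition cycleS : set (seq (edge E)) :=
  [set c | [/\ is_cycle c,
               (forall e, ~ is_exit c e) &
               finite_set [set p : prepath |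
                 [/\ is_path p, cycle_vertices c (path_range p)
                   & ~~ infix c p.2]]]].

(* [belast] drops the last item of v :: [:: r(e1); ...; r(ek)], so that the
   second condition is about s(e1) = v, r(e1), ..., r(e_(k-1)). *)
Definition first_entry (X : set (vertex E)) : set prepath :=
  [set p | [/\ is_path p, p.2 != [::],
               (forall w, w \in belast p.1 [seq erange e | e <- p.2] -> ~ X w) &
               X (path_range p)]].

Definition trivial_paths (X : set (vertex E)) : set prepath :=
  [set p | X p.1 /\ p.2 = [::]].

End Paths.

(* Formal expressions in the generators v, e, e^*, to be quotiented by the
   smallest congruence containing the laws of (not necessarily unital)
   associative K-algebras and the Leavitt relations. *)
Inductive lterm (E : digraph) (K : fieldType) : Type :=
| TVertex of vertex E
| TEdge of edge E
| TGhost of edge E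
| TZero
| TAdd of lterm E K & lterm E K
| TScale of K & lterm E K
| TMul of lterm E K & lterm E K.

Arguments TVertex {E K}.
Arguments TEdge {E K}.
Arguments TGhost {E K}.
Arguments TZero {E K}.

HB.instance Definition _ (E : digraph) (K : fieldType) :=
  gen_eqMixin (lterm E K).
HB.instance Definition _ (E : digraph) (K : fieldType) :=
  gen_choiceMixin (lterm E K).

Inductive lequiv (E : digraph) (K : fieldType) : lterm E K -> lterm E K -> Prop :=
| lequiv_refl t : lequiv t t
| lequiv_sym t u : lequiv t u -> lequiv u t
| lequiv_trans t u w : lequiv t u -> lequiv u w -> lequiv t w
| lequiv_add t t' u u' :
    lequiv t t' -> lequiv u u' -> lequiv (TAdd t u) (TAdd t' u')
| lequiv_scale a t t' : lequiv t t' -> lequiv (TScale a t) (TScale a t')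
| lequiv_mul t t' u u' :
    lequiv t t' -> lequiv u u' -> lequiv (TMul t u) (TMul t' u')
| lequiv_addA t u w : lequiv (TAdd t (TAdd u w)) (TAdd (TAdd t u) w)
| lequiv_addC t u : lequiv (TAdd t u) (TAdd u t)
| lequiv_add0 t : lequiv (TAdd TZero t) t
| lequiv_addN t : lequiv (TAdd (TScale (-1) t) t) TZero
| lequiv_scaleA a b t : lequiv (TScale a (TScale b t)) (TScale (a * b) t)
| lequiv_scale1 t : lequiv (TScale 1 t) t
| lequiv_scaleDr a t u :
    lequiv (TScale a (TAdd t u)) (TAdd (TScale a t) (TScale a u))
| lequiv_scaleDl a b t :
    lequiv (TScale (a + b) t) (TAdd (TScale a t) (TScale b t))
| lequiv_mulA t u w : lequiv (TMul t (TMul u w)) (TMul (TMul t u) w)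
| lequiv_mulDl t u w : lequiv (TMul (TAdd t u) w) (TAdd (TMul t w) (TMul u w))
| lequiv_mulDr t u w : lequiv (TMul t (TAdd u w)) (TAdd (TMul t u) (TMul t w))
| lequiv_scaleAl a t u : lequiv (TMul (TScale a t) u) (TScale a (TMul t u))
| lequiv_scaleAr a t u : lequiv (TMul t (TScale a u)) (TScale a (TMul t u))
| lequiv_vv v : lequiv (TMul (TVertex v) (TVertex v)) (TVertex v)
| lequiv_vw v w : v <> w -> lequiv (TMul (TVertex v) (TVertex w)) TZero
| lequiv_se e : lequiv (TMul (TVertex (esource e)) (TEdge e)) (TEdge e)
| lequiv_er e : lequiv (TMul (TEdge e) (TVertex (erange e))) (TEdge e)
| lequiv_rg e : lequiv (TMul (TVertex (erange e)) (TGhost e)) (TGhost e)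
| lequiv_gs e : lequiv (TMul (TGhost e) (TVertex (esource e))) (TGhost e)
| lequiv_gg e : lequiv (TMul (TGhost e) (TEdge e)) (TVertex (erange e))
| lequiv_gh e f : e <> f -> lequiv (TMul (TGhost e) (TEdge f)) TZero
(* v is regular exactly when some nonempty duplicate-free s enumerates the
   edges with source v. *)
| lequiv_ck2 v (s : seq (edge E)) :
    s <> [::] -> uniq s -> (forall e, e \in s <-> esource e = v) ->
    lequiv (TVertex v)
           (foldr (fun e t => TAdd (TMul (TEdge e) (TGhost e)) t) TZero s).

Section LeavittPathAlgebra.
Variables (E : digraph) (K : fieldType).
Implicit Types (t u : lterm E K).

Definition lequivb : rel (lterm E K) := fun t u => `[< lequiv t u >].

Lemma lequivb_refl : reflexive lequivb.
Proof. by move=> t; apply/asboolP; apply: lequiv_refl. Qed.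

Lemma lequivb_sym : symmetric lequivb.
Proof. by move=> t u; apply/asboolP/asboolP; apply: lequiv_sym. Qed.

Lemma lequivb_trans : transitive lequivb.
Proof.
by move=> u t w /asboolP tu /asboolP uw; apply/asboolP; apply: lequiv_trans tu uw.
Qed.

Canonical lequiv_equiv :=
  EquivRel lequivb lequivb_refl lequivb_sym lequivb_trans.

Definition leavitt : Type := {eq_quot lequiv_equiv}.
HB.instance Definition _ := Choice.on leavitt.

Definition lclass t : leavitt := \pi_({eq_quot lequiv_equiv}) t.
Definition lrepr (x : leavitt) : lterm E K :=
  repr (x : {eq_quot lequiv_equiv}).

Lemma lreprK : cancel lrepr lclass.
Proof. exact: (@reprK _ {eq_quot lequiv_equiv}). Qed.

Lemma lclassP t u : lclass t = lclass u <-> lequiv t u.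
Proof.
rewrite /lclass; split.
  by move=> /(@eqmodP _ lequiv_equiv)/asboolP.
by move=> tu; apply/(@eqmodP _ lequiv_equiv)/asboolP.
Qed.

Lemma lrepr_class t : lequiv (lrepr (lclass t)) t.
Proof. by apply/lclassP; rewrite lreprK. Qed.

Definition ladd (x y : leavitt) := lclass (TAdd (lrepr x) (lrepr y)).
Definition lscale (a : K) (x : leavitt) := lclass (TScale a (lrepr x)).
Definition lmul (x y : leavitt) := lclass (TMul (lrepr x) (lrepr y)).

Lemma lclass_add t u : ladd (lclass t) (lclass u) = lclass (TAdd t u).
Proof. by apply/lclassP; apply: lequiv_add; apply: lrepr_class. Qed.

Lemma lclass_scale a t : lscale a (lclass t) = lclass (TScale a t).
Proof. by apply/lclassP; apply: lequiv_scale; apply: lrepr_class. Qed.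

Lemma lclass_mul t u : lmul (lclass t) (lclass u) = lclass (TMul t u).
Proof. by apply/lclassP; apply: lequiv_mul; apply: lrepr_class. Qed.

Definition lclassE := (lclass_add, lclass_scale, lclass_mul).

Fact laddA : associative ladd.
Proof.
move=> x y z; rewrite -(lreprK x) -(lreprK y) -(lreprK z) !lclassE.
by apply/lclassP; apply: lequiv_addA.
Qed.

Fact laddC : commutative ladd.
Proof.
move=> x y; rewrite -(lreprK x) -(lreprK y) !lclassE.
by apply/lclassP; apply: lequiv_addC.
Qed.

Fact ladd0 : left_id (lclass TZero) ladd.
Proof.
by move=> x; rewrite -(lreprK x) !lclassE; apply/lclassP; apply: lequiv_add0.
Qed.

Fact laddN : left_inverse (lclass TZero) (lscale (-1)) ladd.
Proof.
by move=> x; rewrite -(lreprK x) !lclassE; apply/lclassP; apply: lequiv_addN.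
Qed.

HB.instance Definition _ := GRing.isZmodule.Build leavitt laddA laddC ladd0 laddN.

Fact lscaleA a b x : lscale a (lscale b x) = lscale (a * b) x.
Proof.
by rewrite -(lreprK x) !lclassE; apply/lclassP; apply: lequiv_scaleA.
Qed.

Fact lscale1 : left_id 1 lscale.
Proof.
by move=> x; rewrite -(lreprK x) !lclassE; apply/lclassP; apply: lequiv_scale1.
Qed.

Fact lscaleDr : right_distributive lscale +%R.
Proof.
move=> a x y; rewrite -(lreprK x) -(lreprK y) /GRing.add /= !lclassE.
by apply/lclassP; apply: lequiv_scaleDr.
Qed.

Fact lscaleDl x : {morph lscale^~ x : a b / a + b}.
Proof.
move=> a b; rewrite -(lreprK x) /= [RHS]/GRing.add /= !lclassE.
by apply/lclassP; apply: lequiv_scaleDl.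
Qed.

HB.instance Definition _ :=
  GRing.Zmodule_isLmodule.Build K leavitt lscaleA lscale1 lscaleDr lscaleDl.

Definition lvertex (v : vertex E) : leavitt := lclass (TVertex v).
Definition ledge (e : edge E) : leavitt := lclass (TEdge e).
Definition lghost (e : edge E) : leavitt := lclass (TGhost e).

Definition lpath (p : prepath E) : leavitt :=
  if p.2 is e :: s then foldl (fun x f => lmul x (ledge f)) (ledge e) s
  else lvertex p.1.

(* (e1 ... ek)^* = ek^* ... e1^* *)
Definition lpath_star (p : prepath E) : leavitt :=
  if p.2 is e :: s then foldl (fun x f => lmul (lghost f) x) (lghost e) s
  else lvertex p.1.

(* [Negz m] is - (m + 1). *)
Definition cycle_power (c : seq (edge E)) (u : vertex E) (m : int) : leavitt :=
  let x := lpath (u, cycle_at c u) in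
  let y := lpath_star (u, cycle_at c u) in
  match m with
  | Posz 0 => lvertex u
  | Posz m'.+1 => iter m' (lmul x) x
  | Negz m' => iter m' (lmul y) y
  end.

Definition linear_span (V : lmodType K) (B : set V) : set V :=
  [set x | exists (s : seq V) (a : V -> K),
     (forall b, b \in s -> B b) /\ x = \sum_(b <- s) a b *: b].

Definition lin_indep (V : lmodType K) (B : set V) : Prop :=
  forall (s : seq V) (a : V -> K), uniq s -> (forall b, b \in s -> B b) ->
    \sum_(b <- s) a b *: b = 0 -> forall b, b \in s -> a b = 0.

Definition is_basis_of (V : lmodType K) (B W : set V) : Prop :=
  lin_indep B /\ linear_span B = W.

Definition lhomogeneous (n : int) : set leavitt :=
  linear_span [set x | exists p q : prepath E,
    [/\ is_path p, is_path q, (size p.2)%:Z - (size q.2)%:Z = n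
      & x = lmul (lpath p) (lpath_star q)]].

Definition lcenter : set leavitt := [set z | forall x, lmul z x = lmul x z].

Definition center_homogeneous (n : int) : set leavitt :=
  lcenter `&` lhomogeneous n.

(* For c in [cycleS E] the index set is finite; a sum [\sum_(i \in A) F i] is 0
   by convention when F has infinite support in A. *)
Definition cycle_sum (c : seq (edge E)) (m : int) : leavitt :=
  \sum_(i \in (first_entry (cycle_vertices c)
                 `|` trivial_paths (cycle_vertices c)) `*` cycle_vertices c)
    lmul (lmul (lpath i.1) (cycle_power c i.2 m)) (lpath_star i.1).

Definition center_basis (n : int) : set leavitt :=
  [set x | exists (c : seq (edge E)) (m : int),
     [/\ cycleS c, m * (size c)%:Z = n & x = cycle_sum c m]].

End LeavittPathAlgebra.

Arguments linear_span {K V}.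
Arguments lin_indep {K V}.
Arguments is_basis_of {K V}.
Arguments center_basis : clear implicits.
Arguments center_homogeneous : clear implicits.

(* Main.v *)
From HB Require Import structures.
Require Import Defs.
From mathcomp Require Import all_boot all_order all_algebra.
From mathcomp Require Import boolp classical_sets functions cardinality fsbigop.
From mathcomp Require Import finmap.

Set Implicit Arguments.
Unset Strict Implicit.
Unset Printing Implicit Defensive.

Import GRing.Theory.
Local Open Scope classical_set_scope.
Local Open Scope ring_scope.

(* Let z be central, homogeneous of degree n > 0, and write z as a combination
   of terms p q^* with all q of length at most N.  For paths q of length N and
   t of length n starting at r(q), t^* z = (q t)^* z q is a scalar multiple of
   the vertex r(q).  When it is nonzero, t is closed, and conjugating by edges
   shows that t has no exit, so t is a power of a cycle c without exits and
   r(q) z = a c_u^m.  Since r(q) z = q^* z q, every vertex from which such a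
   cycle can be reached belongs to the finite support of z; hence c is in S,
   and z minus a times the central element attached to (c, m) vanishes at more
   vertices lying on cycles without exits.  A central element that vanishes at
   all of these is 0.  Independence follows by multiplying with a vertex of the
   cycle, as vertices are nonzero in the algebra.  The involution exchanges the
   degrees n and -n. *)

Local Notation "x ** y" := (lmul x y) (at level 40, left associativity).

(** * Linear spans and bases *)

Section LinearSpan.
Variables (K : fieldType) (V : lmodType K).
Implicit Types (B : set V) (x y : V).

(** The pairs may repeat a vector, so two combinations add by concatenation; summing the
    coefficients of equal vectors recovers a coefficient function. *)
Lemma linear_spanP B x :
  linear_span B x <->
  exists r : seq (K * V),
    (forall i, i \in r -> B i.2) /\ x = \sum_(i <- r) i.1 *: i.2.
Proof.
split=> [[s [a [sB ->]]]|[r [rB ->]]].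
  exists [seq (a b, b) | b <- s]; split; last by rewrite big_map.
  by move=> _ /mapP[b /sB bB ->].
exists (undup [seq i.2 | i <- r]), (fun b => \sum_(i <- r | i.2 == b) i.1); split.
  by move=> b; rewrite mem_undup => /mapP[i /rB ? ->].
under [RHS]eq_bigr do rewrite scaler_suml.
rewrite (exchange_big_dep xpredT) //= [LHS]big_seq [RHS]big_seq.
apply: eq_bigr => i ir; rewrite big_mkcond (bigD1_seq i.2) ?undup_uniq //=; last first.
  by rewrite mem_undup map_f.
rewrite eqxx big1 ?addr0// => b; rewrite eq_sym.
by move=> /negPf ->.
Qed.

Lemma linear_span_comb B (a : K) x y :
  linear_span B x -> linear_span B y -> linear_span B (a *: x + y).
Proof.
move=> /linear_spanP[r [rB ->]] /linear_spanP[r' [r'B ->]].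
apply/linear_spanP; exists ([seq (a * i.1, i.2) | i <- r] ++ r'); split.
  by move=> i; rewrite mem_cat => /orP[/mapP[j jr ->]|]; [exact: (rB j) | exact: r'B].
rewrite big_cat big_map /= scaler_sumr; congr (_ + _).
by apply: eq_bigr => i _; rewrite scalerA.
Qed.

Lemma linear_span0 B : linear_span B 0.
Proof. by exists [::], (fun=> 0); split=> //; rewrite big_nil. Qed.

Lemma linear_span_sub B : B `<=` linear_span B.
Proof.
move=> b Bb; exists [:: b], (fun=> 1); split; last by rewrite big_seq1 scale1r.
by move=> c; rewrite inE => /eqP ->.
Qed.

Lemma linear_span_min B (P : set V) :
  P 0 -> (forall a x y, P x -> P y -> P (a *: x + y)) -> B `<=` P ->
  linear_span B `<=` P.
Proof.
move=> P0 PD BP _ [s [a [sB ->]]].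
elim: s sB => [|b s IHs] sB; first by rewrite big_nil.
rewrite big_cons; apply: PD; first by apply/BP/sB; rewrite mem_head.
by apply: IHs => c cs; apply: sB; rewrite in_cons cs orbT.
Qed.

(** As [f] is its own inverse, preimages under it are images. With the involution of the algebra for
    [f], this passes from degree n to degree -n. *)
Lemma is_basis_of_preimage B W (f : {linear V -> V}) :
  involutive f -> is_basis_of B W ->
  is_basis_of (f @^-1` B) (f @^-1` W).
Proof.
move=> fK [free_B <-].
have fsum (s : seq V) (a : V -> K) :
    f (\sum_(b <- s) a b *: b) = \sum_(b <- [seq f b | b <- s]) a (f b) *: b.
  rewrite linear_sum big_map /=; apply: eq_bigr => b _.
  by rewrite linearZ /= fK.
have fmap (s : seq V) (Q : V -> Prop) : (forall b, b \in s -> Q (f b)) ->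
    forall b, b \in [seq f b | b <- s] -> Q b.
  by move=> sQ _ /mapP[b /sQ Qfb ->].
split.
  move=> s a us sB sum0 b bs.
  rewrite -[b]fK; apply: (free_B [seq f b | b <- s] (a \o f)) => /=.
  - by rewrite map_inj_uniq//; exact: inv_inj.
  - exact: fmap.
  - by rewrite -fsum sum0 linear0.
  - by rewrite map_f.
apply/seteqP; split=> x /= [s [a [sB ex]]].
  by exists [seq f b | b <- s], (a \o f); split; [exact: fmap | rewrite ex fsum].
exists [seq f b | b <- s], (a \o f); split; last by rewrite -fsum -ex fK.
by apply: fmap => b bs /=; rewrite fK; exact: sB.
Qed.

End LinearSpan.

(** * Algebra laws, defining relations and the involution *)

Section LeavittAlgebra.
Variables (E : digraph) (K : fieldType).
Local Notation L := (leavitt E K).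
Implicit Types (x y z : L) (t u : lterm E K) (v w : vertex E) (e f : edge E).

Lemma laddE x y : x + y = ladd x y. Proof. by []. Qed.

Lemma lzeroE : 0 = lclass TZero :> L. Proof. by []. Qed.

Lemma lmulA : associative (@lmul E K).
Proof.
move=> x y z; rewrite -(lreprK x) -(lreprK y) -(lreprK z) !lclassE.
by apply/lclassP; exact: lequiv_mulA.
Qed.

Lemma lmulDl : left_distributive (@lmul E K) +%R.
Proof.
move=> x y z; rewrite -(lreprK x) -(lreprK y) -(lreprK z) !laddE !lclassE.
by apply/lclassP; exact: lequiv_mulDl.
Qed.

Lemma lmulDr : right_distributive (@lmul E K) +%R.
Proof.
move=> x y z; rewrite -(lreprK x) -(lreprK y) -(lreprK z) !laddE !lclassE.
by apply/lclassP; exact: lequiv_mulDr.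
Qed.

Lemma lscaleAl (a : K) x y : (a *: x) ** y = a *: (x ** y).
Proof.
rewrite -(lreprK x) -(lreprK y) /GRing.scale /= !lclassE.
by apply/lclassP; exact: lequiv_scaleAl.
Qed.

Lemma lscaleAr (a : K) x y : x ** (a *: y) = a *: (x ** y).
Proof.
rewrite -(lreprK x) -(lreprK y) /GRing.scale /= !lclassE.
by apply/lclassP; exact: lequiv_scaleAr.
Qed.

Lemma lmul0l x : 0 ** x = 0 :> L.
Proof. by rewrite -(scale0r 0) lscaleAl !scale0r. Qed.

Lemma lmul0r x : x ** 0 = 0 :> L.
Proof. by rewrite -(scale0r 0) lscaleAr !scale0r. Qed.

Lemma lmul_suml (I : Type) (r : seq I) (P : pred I) (F : I -> L) x :
  (\sum_(i <- r | P i) F i) ** x = \sum_(i <- r | P i) F i ** x.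
Proof. exact: (big_morph (fun y => y ** x) (fun y z => lmulDl y z x) (lmul0l x)). Qed.

Lemma lmul_sumr (I : Type) (r : seq I) (P : pred I) (F : I -> L) x :
  x ** (\sum_(i <- r | P i) F i) = \sum_(i <- r | P i) x ** F i.
Proof. exact: (big_morph (lmul x) (lmulDr x) (lmul0r x)). Qed.

Local Notation V := (@lvertex E K).
Local Notation G := (@ledge E K).
Local Notation H := (@lghost E K).

Lemma lvertexM v w : V v ** V w = if v == w then V v else 0.
Proof.
rewrite lzeroE !lclassE; case: eqP => [->|vw]; apply/lclassP.
  exact: lequiv_vv.
exact: lequiv_vw.
Qed.

Lemma lvertexK v : V v ** V v = V v.
Proof. by rewrite lvertexM eqxx. Qed.

Lemma lvertex_edge e : V (esource e) ** G e = G e.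
Proof. by rewrite !lclassE; apply/lclassP; exact: lequiv_se. Qed.

Lemma ledge_vertex e : G e ** V (erange e) = G e.
Proof. by rewrite !lclassE; apply/lclassP; exact: lequiv_er. Qed.

Lemma lvertex_ghost e : V (erange e) ** H e = H e.
Proof. by rewrite !lclassE; apply/lclassP; exact: lequiv_rg. Qed.

Lemma lghost_vertex e : H e ** V (esource e) = H e.
Proof. by rewrite !lclassE; apply/lclassP; exact: lequiv_gs. Qed.

Lemma lghost_edge e f : H e ** G f = if e == f then V (erange e) else 0.
Proof.
rewrite lzeroE !lclassE; case: eqP => [->|ef]; apply/lclassP.
  exact: lequiv_gg.
exact: lequiv_gh.
Qed.

Lemma lghost_edgeK e : H e ** G e = V (erange e).
Proof. by rewrite lghost_edge eqxx. Qed.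

Lemma lvertex_ck2 v (s : seq (edge E)) :
  s <> [::] -> uniq s -> (forall e, e \in s <-> esource e = v) ->
  V v = \sum_(e <- s) G e ** H e.
Proof.
move=> s0 us sv; transitivity
  (lclass (foldr (fun e t => TAdd (TMul (TEdge e) (TGhost e)) t) TZero s)).
  by apply/lclassP; exact: lequiv_ck2.
elim: s {s0 us sv} => [|e s IHs]; first by rewrite big_nil.
by rewrite big_cons -IHs laddE lclass_mul lclass_add.
Qed.

Fixpoint term_star t : lterm E K :=
  match t with
  | TVertex v => TVertex v
  | TEdge e => TGhost e
  | TGhost e => TEdge e
  | TZero => TZero
  | TAdd t u => TAdd (term_star t) (term_star u)
  | TScale a t => TScale a (term_star t)
  | TMul t u => TMul (term_star u) (term_star t)
  end.

(** The relations are stable under reversal: the source and range relations of edges are exchanged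
    with those of ghosts, and each e e^* is fixed. *)
Lemma lequiv_star t u : lequiv t u -> lequiv (term_star t) (term_star u).
Proof.
elim=> /=; try by constructor.
- by move=> t1 t2 t3 _ ? _ ?; apply: lequiv_trans; eassumption.
- by move=> t1 t2 t3; apply: lequiv_sym; exact: lequiv_mulA.
- by move=> v w vw; apply: lequiv_vw => wv; exact/vw/esym.
- by move=> e f ef; apply: lequiv_gh => fe; exact/ef/esym.
- move=> v s s0 us sv.
  rewrite (_ : term_star _ =
    foldr (fun e t => TAdd (TMul (TEdge e) (TGhost e)) t) TZero s).
    exact: lequiv_ck2.
  by elim: s {s0 us sv} => //= e s ->.
Qed.

Definition lstar x : L := lclass (term_star (lrepr x)).

Lemma lstar_class t : lstar (lclass t) = lclass (term_star t).
Proof. by apply/lclassP/lequiv_star; exact: lrepr_class. Qed.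

Lemma lstarK : involutive lstar.
Proof.
move=> x; rewrite -(lreprK x) !lstar_class; congr lclass.
by elim: (lrepr x) => //= [t -> u ->|a t ->|t -> u ->].
Qed.

Lemma lstarM x y : lstar (x ** y) = lstar y ** lstar x.
Proof. by rewrite -(lreprK x) -(lreprK y) lclass_mul !lstar_class lclass_mul. Qed.

Lemma lstar_linear : linear lstar.
Proof.
move=> a x y; rewrite -(lreprK x) -(lreprK y).
rewrite /GRing.scale /= !laddE lclass_scale lclass_add !lstar_class.
by rewrite lclass_scale lclass_add.
Qed.

HB.instance Definition _ :=
  GRing.isLinear.Build K L L *:%R lstar lstar_linear.

Lemma lstar_vertex v : lstar (V v) = V v.
Proof. by rewrite lstar_class. Qed.

Lemma lstar_edge e : lstar (G e) = H e.
Proof. by rewrite lstar_class. Qed.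

(** The elements commuting with [z] form a subalgebra. *)
Lemma lcenter_generators z :
  (forall v, z ** V v = V v ** z) -> (forall e, z ** G e = G e ** z) ->
  (forall e, z ** H e = H e ** z) -> lcenter z.
Proof.
move=> zV zG zH x; rewrite -(lreprK x).
elim: (lrepr x) => [v|e|e||t IHt u IHu|a t IHt|t IHt u IHu].
- exact: zV.
- exact: zG.
- exact: zH.
- by rewrite -[lclass _]/(0 : L) lmul0l lmul0r.
- rewrite -lclass_add -[ladd _ _]/(lclass t + lclass u).
  by rewrite lmulDl lmulDr IHt IHu.
- rewrite -lclass_scale -[lscale _ _]/(a *: (lclass t : L)).
  by rewrite lscaleAl lscaleAr IHt.
- by rewrite -lclass_mul lmulA IHt -lmulA IHu lmulA.
Qed.

Lemma lcenter_comb (a : K) x y :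
  lcenter x -> lcenter y -> lcenter (a *: x + y).
Proof.
by move=> xc yc z; rewrite lmulDl lmulDr lscaleAl lscaleAr xc yc.
Qed.

Lemma lcenter_star z : lcenter z -> lcenter (lstar z).
Proof. by move=> zc x; rewrite -(lstarK x) -!lstarM zc. Qed.

End LeavittAlgebra.

(** * Enumeration of outgoing edges *)

Section OutEdges.
Variable E : digraph.
Implicit Types (v w : vertex E) (e f : edge E).

(** [fset_set] is empty on an infinite set, so this enumerates the outgoing edges only at vertices
    that emit finitely many. *)
Definition out v : seq (edge E) := fset_set [set e : edge E | esource e = v].

Lemma out_uniq v : uniq (out v).
Proof. exact: fset_uniq. Qed.

Lemma mem_out (rfE : row_finite E) v e : (e \in out v) = (esource e == v).
Proof.
rewrite -[LHS]/(e \in fset_set _) in_fset_set; last exact: rfE.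
by apply/idP/eqP => [/set_mem|/mem_set].
Qed.

End OutEdges.

(** * A representation in which vertices act as nonzero operators *)

Section NonzeroVertices.
Variables (E : digraph) (K : fieldType) (rfE : row_finite E).
Local Notation V := (@lvertex E K).
Implicit Types (t u : lterm E K) (v w : vertex E) (e : edge E).
Implicit Types (f g : vertex E -> nat -> K).

(* If v emits k > 0 edges, n |-> (n %% k, n %/ k) identifies nat with a union of
   k copies of nat, which turns K^nat at v into the direct product of the K^nat
   at the ranges of these edges. *)
Fixpoint action t f : vertex E -> nat -> K :=
  match t with
  | TVertex v => fun w n => if w == v then f w n else 0
  | TEdge e => fun w n =>
      if (esource e == w) && (n %% size (out w) == index e (out w))%N
      then f (erange e) (n %/ size (out w))%N else 0
  | TGhost e => fun w n =>
      if erange e == w then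
        f (esource e) (n * size (out (esource e)) + index e (out (esource e)))%N
      else 0
  | TZero => fun _ _ => 0
  | TAdd t u => fun w n => action t f w n + action u f w n
  | TScale a t => fun w n => a * action t f w n
  | TMul t u => action t (action u f)
  end.

Lemma action_comb t (a : K) f g w n :
  action t (fun w n => a * f w n + g w n) w n
  = a * action t f w n + action t g w n.
Proof.
elim: t f g w n => [v|e|e||t IHt u IHu|b t IHt|t IHt u IHu] f g w n /=.
- by case: eqP; rewrite ?mulr0 ?addr0.
- by case: andP; rewrite ?mulr0 ?addr0.
- by case: eqP; rewrite ?mulr0 ?addr0.
- by rewrite mulr0 addr0.
- by rewrite IHt IHu mulrDr addrACA.
- by rewrite IHt mulrDr mulrCA.
- rewrite -IHt; congr action; apply/funext => w'; apply/funext => n'.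
  exact: IHu.
Qed.

Lemma action_add t f g w n :
  action t (fun w n => f w n + g w n) w n = action t f w n + action t g w n.
Proof.
rewrite -[action t f w n]mul1r -action_comb; congr action.
by apply/funext => w'; apply/funext => n'; rewrite mul1r.
Qed.

Lemma action_zero t w n : action t (fun _ _ => 0) w n = 0.
Proof.
transitivity (action t (fun _ _ => (-1) * 0 + 0) w n).
  by congr action; apply/funext => w'; apply/funext => n'; rewrite mulr0 addr0.
by rewrite (action_comb t (-1) (fun=> fun=> 0) (fun=> fun=> 0)) mulN1r addNr.
Qed.

Lemma action_scale t (a : K) f w n :
  action t (fun w n => a * f w n) w n = a * action t f w n.
Proof.
transitivity (action t (fun w n => a * f w n + 0) w n).
  by congr action; apply/funext => w'; apply/funext => n'; rewrite addr0.
by rewrite action_comb action_zero addr0.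
Qed.

Lemma index_out_lt e : (index e (out (esource e)) < size (out (esource e)))%N.
Proof. by rewrite index_mem mem_out. Qed.

Lemma action_sound t u : lequiv t u -> action t = action u.
Proof.
elim=> {t u}; try by move=> *; apply/funext => f; apply/funext => w;
  apply/funext => n /=; rewrite ?addrA ?add0r ?mul1r ?mulrDr ?mulrDl ?mulrA
    ?action_add ?action_scale ?action_zero //.
- by move=> t u _ ->.
- by move=> t u s _ -> _ ->.
- by move=> t t' u u' _ /= -> _ ->.
- by move=> a t t' _ /= ->.
- by move=> t t' u u' _ /= -> _ ->.
- by move=> t u /=; apply/funext => f; apply/funext => w; apply/funext => n; rewrite addrC.
- by move=> t /=; apply/funext => f; apply/funext => w; apply/funext => n; rewrite mulN1r addNr.
- by move=> v; apply/funext => f; apply/funext => w; apply/funext => n /=; case: eqP.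
- move=> v w vw; apply/funext => f; apply/funext => w'; apply/funext => n /=.
  by case: eqP => // ->; case: eqP.
- move=> e; apply/funext => f; apply/funext => w; apply/funext => n /=.
  by rewrite [w == _]eq_sym; case: eqP.
- move=> e; apply/funext => f; apply/funext => w; apply/funext => n /=.
  by rewrite eqxx.
- move=> e; apply/funext => f; apply/funext => w; apply/funext => n /=.
  by rewrite [w == _]eq_sym; case: eqP.
- move=> e; apply/funext => f; apply/funext => w; apply/funext => n /=.
  by rewrite eqxx.
- move=> e; apply/funext => f; apply/funext => w; apply/funext => n /=.
  have lt_e := index_out_lt e.
  rewrite [w == _]eq_sym; case: eqP => // <-; rewrite eqxx modnMDl modn_small// eqxx.
  by rewrite divnMDl ?divn_small ?addn0//; exact: leq_ltn_trans lt_e.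
- move=> e e' ee'; apply/funext => f; apply/funext => w; apply/funext => n /=.
  case: eqP => //= _; case: eqP => //= se; rewrite modnMDl modn_small ?index_out_lt//.
  case: eqP => // /(congr1 (nth e (out (esource e)))).
  by rewrite !nth_index ?mem_out ?se ?eqxx// => /ee'.
- move=> v s s0 us sv; apply/funext => f; apply/funext => w; apply/funext => n.
  have os : perm_eq (out v) s.
    apply: uniq_perm => //; first exact: out_uniq.
    by move=> e; rewrite mem_out//; apply/eqP/idP => /sv.
  have -> : action (foldr (fun e t => TAdd (TMul (TEdge e) (TGhost e)) t) TZero s)
      f w n = \sum_(e <- s) action (TMul (TEdge e) (TGhost e)) f w n.
    elim: s {s0 us sv os} => [|e s IHs]; first by rewrite big_nil.
    by rewrite big_cons -IHs.
  rewrite -(perm_big _ os) /= big_seq.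
  under eq_bigr => e do rewrite mem_out// => /eqP ->.
  rewrite eq_sym; case: eqP => [<-|_]; last by rewrite big1.
  have sz0 : (0 < size (out v))%N.
    by rewrite (perm_size os) lt0n; apply/eqP => /size0nil.
  have [e0 _] : exists e : edge E, True by case: (out v) sz0 => // e; exists e.
  (* Coordinate [n] lies in the copy of nat numbered by its remainder, so only the edge [e1] with
     that index contributes; Euclidean division restores [n]. *)
  pose e1 := nth e0 (out v) (n %% size (out v)).
  have lt_n : (n %% size (out v) < size (out v))%N by rewrite ltn_pmod.
  have e1v : e1 \in out v by exact: mem_nth.
  rewrite -big_seq (bigD1_seq e1) ?out_uniq//=.
  rewrite index_uniq ?out_uniq// eqxx /= eqxx -divn_eq big1_seq ?addr0//.
  move=> e /andP[ne ev]; case: eqP => // ie.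
  by move: ne; rewrite /e1 ie nth_index// eqxx.
Qed.

(** A vertex equal to 0 would act as 0, yet [v] preserves the value 1 at [v] of the constant
    function 1. *)
Lemma lvertex_neq0 v : V v <> 0.
Proof.
move=> /lclassP/action_sound /(congr1 (fun F => F (fun _ _ => 1) v 0%N)) /=.
by rewrite eqxx => /eqP; rewrite oner_eq0.
Qed.

End NonzeroVertices.

(** * Paths with explicit endpoints *)

Section Walks.
Variable E : digraph.
Implicit Types (s : seq (edge E)) (u v w : vertex E) (e f : edge E).

(** The recursive counterpart of [is_path] with [path_range]; naming both endpoints suits
    concatenation and induction on the edges. *)
Fixpoint walk v s w : bool :=
  if s is e :: s' then (esource e == v) && walk (erange e) s' w else v == w.

Lemma walkE v s w : walk v s w = is_path (v, s) && (path_range (v, s) == w).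
Proof.
rewrite /is_path /path_range /=; elim: s v => [|e s IHs] v //=.
rewrite IHs andbA; congr (_ && _); rewrite andbC; congr (_ && _).
case: s {IHs} => [|f s] //=.
by rewrite /composable [esource f == _]eq_sym; case: (path _ f s); rewrite ?andbT ?andbF.
Qed.

Lemma walkP v s : is_path (v, s) -> walk v s (path_range (v, s)).
Proof. by move=> vs; rewrite walkE vs eqxx. Qed.

Lemma walk_range v s w : walk v s w -> path_range (v, s) = w.
Proof. by rewrite walkE => /andP[_ /eqP]. Qed.

Lemma walk_path v s w : walk v s w -> is_path (v, s).
Proof. by rewrite walkE => /andP[]. Qed.

Lemma walk_cat v s1 s2 u w : walk v s1 u -> walk v (s1 ++ s2) w = walk u s2 w.
Proof. by elim: s1 v => [|e s IHs] v /= => [/eqP ->|/andP[-> /IHs ->]]. Qed.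

Lemma walk_catP v s1 s2 w :
  walk v (s1 ++ s2) w -> exists2 u, walk v s1 u & walk u s2 w.
Proof.
elim: s1 v => [|e s IHs] v /=; first by exists v.
by move=> /andP[-> /IHs[u]]; exists u.
Qed.

Lemma walk_mem v s w e :
  walk v s w -> e \in s -> exists s1 s2,
    [/\ s = s1 ++ e :: s2, walk v s1 (esource e) & walk (esource e) (e :: s2) w].
Proof.
move=> vsw es; case/splitPr: es vsw => s1 s2 /walk_catP[u vu uw].
have /= /andP[/eqP eu _] := uw.
by exists s1, s2; subst u; split=> //; rewrite eqxx; case/andP: uw.
Qed.

Definition sole e := forall f, esource f = esource e -> f = e.

(** At each vertex of the first walk the next edge is forced, so the second walk follows the first
    to its end. *)
Lemma walk_sole_prefix v s1 s2 w1 w2 :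
  walk v s1 w1 -> walk v s2 w2 -> (forall e, e \in s1 -> sole e) ->
  (size s1 <= size s2)%N -> exists s3, s2 = s1 ++ s3.
Proof.
elim: s1 v s2 => [|e s1 IHs] v [|f s2] //=; try by move=> *; eexists.
move=> /andP[/eqP ev s1w] /andP[/eqP fv s2w] sole1 le12.
have fe : f = e by apply: sole1; rewrite ?mem_head // fv ev.
case: (IHs _ s2 s1w) => [||//|s3 ->]; first by rewrite -fe.
  by move=> g gs; apply: sole1; rewrite in_cons gs orbT.
by exists s3; rewrite fe.
Qed.

Lemma walk_sole_eq v s1 s2 w1 w2 :
  walk v s1 w1 -> walk v s2 w2 -> (forall e, e \in s1 -> sole e) ->
  size s1 = size s2 -> s1 = s2.
Proof.
move=> vs1 vs2 sole1 eq12.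
have [|s3 e2] := walk_sole_prefix vs1 vs2 sole1; first by rewrite eq12.
by move: eq12; rewrite e2 size_cat -{1}[size s1]addn0 => /addnI/esym/size0nil ->; rewrite cats0.
Qed.

End Walks.

(** * Products of paths and ghost paths *)

Section PathAlgebra.
Variables (E : digraph) (K : fieldType).
Local Notation L := (leavitt E K).
Local Notation V := (@lvertex E K).
Local Notation G := (@ledge E K).
Local Notation H := (@lghost E K).
Local Notation P := (@lpath E K).
Local Notation S := (@lpath_star E K).
Implicit Types (x y z : L) (s : seq (edge E)) (u v w : vertex E) (e f : edge E).

Lemma lpath_cons v e s : P (v, e :: s) = G e ** P (erange e, s).
Proof.
(* [foldl] accumulates on the left, so the induction needs an arbitrary accumulator [x]; the
   condition on [V u] serves the case without edges. *)
have foldlE s' x u : x ** V u = x ->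
    foldl (fun x f => x ** G f) x s' = x ** P (u, s').
  elim: s' x u => [|f s' IHs] x u xu //=.
  rewrite /lpath /= (IHs (G f) (erange f)) ?ledge_vertex//.
  by rewrite (IHs _ (erange f)) ?lmulA// -lmulA ledge_vertex.
by rewrite -foldlE ?ledge_vertex.
Qed.

Lemma lstar_path p : lstar (P p) = S p.
Proof.
case: p => v [|e s]; first exact: lstar_vertex.
rewrite /lpath /lpath_star /= -lstar_edge.
by elim: s (G e) => [|f s IHs] x //=; rewrite IHs lstarM lstar_edge.
Qed.

Lemma lstar_path_star p : lstar (S p) = P p.
Proof. by rewrite -lstar_path lstarK. Qed.

Lemma lpath_star_cons v e s : S (v, e :: s) = S (erange e, s) ** H e.
Proof. by rewrite -lstar_path lpath_cons lstarM lstar_path lstar_edge. Qed.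

Lemma lvertex_path v s w : walk v s w -> V v ** P (v, s) = P (v, s).
Proof.
case: s => [|e s] /=; first by rewrite lvertexK.
by move=> /andP[/eqP <- _]; rewrite lpath_cons lmulA lvertex_edge.
Qed.

Lemma lpath_vertex v s w : walk v s w -> P (v, s) ** V w = P (v, s).
Proof.
elim: s v => [|e s IHs] v /=; first by move=> /eqP ->; rewrite lvertexK.
by move=> /andP[_ sw]; rewrite lpath_cons -lmulA IHs.
Qed.

Lemma lvertex_path_neq u v s w : walk v s w -> u != v -> V u ** P (v, s) = 0.
Proof.
by move=> /lvertex_path <- uv; rewrite lmulA lvertexM (negPf uv) lmul0l.
Qed.

Lemma lpath_vertex_neq u v s w : walk v s w -> u != w -> P (v, s) ** V u = 0.
Proof.
move=> /lpath_vertex <- uw.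
by rewrite -lmulA lvertexM eq_sym (negPf uw) lmul0r.
Qed.

Lemma lstar_vertex_path v s w : walk v s w -> S (v, s) ** V v = S (v, s).
Proof.
move=> vsw; have := congr1 (@lstar E K) (lvertex_path vsw).
by rewrite lstarM lstar_vertex lstar_path.
Qed.

Lemma lvertex_star v s w : walk v s w -> V w ** S (v, s) = S (v, s).
Proof.
move=> vsw; have := congr1 (@lstar E K) (lpath_vertex vsw).
by rewrite lstarM lstar_vertex lstar_path.
Qed.

Lemma lpath_cat v s1 s2 u w : walk v s1 u -> walk u s2 w ->
  P (v, s1 ++ s2) = P (v, s1) ** P (u, s2).
Proof.
elim: s1 v => [|e s IHs] v /=; first by move=> /eqP -> /lvertex_path ->.
by move=> /andP[_ su] uw; rewrite !lpath_cons (IHs _ su uw) lmulA.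
Qed.

Lemma lpath_star_cat v s1 s2 u w : walk v s1 u -> walk u s2 w ->
  S (v, s1 ++ s2) = S (u, s2) ** S (v, s1).
Proof.
by move=> vu uw; rewrite -!lstar_path (lpath_cat vu uw) lstarM.
Qed.

Lemma lpath_starK v s w : walk v s w -> S (v, s) ** P (v, s) = V w.
Proof.
elim: s v => [|e s IHs] v /=; first by move=> /eqP ->; rewrite lvertexK.
move=> /andP[_ sw]; rewrite lpath_cons lpath_star_cons -lmulA (lmulA (H e)).
by rewrite lghost_edgeK (lvertex_path sw) IHs.
Qed.

Lemma lpath_star_prefix v s1 s2 u w : walk v s1 u -> walk u s2 w ->
  S (v, s1 ++ s2) ** P (v, s1) = S (u, s2).
Proof.
move=> vu uw; rewrite (lpath_star_cat vu uw) -lmulA (lpath_starK vu).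
exact: lstar_vertex_path uw.
Qed.

(** Edges cancel one by one: the product vanishes unless the shorter path is a prefix of the longer,
    and then the ghost of the rest remains. *)
Lemma lpath_star_mul v s w v' s' w' : walk v s w -> walk v' s' w' ->
  (size s' <= size s)%N ->
  S (v, s) ** P (v', s') = 0 \/
  exists s2, [/\ s = s' ++ s2, walk w' s2 w &
    S (v, s) ** P (v', s') = S (w', s2)].
Proof.
elim: s' v v' s => [|e' s' IHs] v v' s vsw /=.
  move=> /eqP <- _; have [->|vv'] := eqVneq v' v.
    by right; exists s; split=> //; exact: lstar_vertex_path vsw.
  by left; rewrite -(lstar_vertex_path vsw) -lmulA lvertexM eq_sym (negPf vv') lmul0r.
case: s vsw => [|e s] //= /andP[/eqP ev ew] /andP[/eqP ev' ew'] le_s.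
rewrite lpath_cons lpath_star_cons -lmulA (lmulA (H e)) lghost_edge.
case: eqP => [ee'|_]; last by left; rewrite lmul0l lmul0r.
subst e'; rewrite (lvertex_path ew').
case: (IHs _ _ _ ew ew' le_s) => [->|[s2 [-> s2w ->]]]; [by left | right].
by exists s2.
Qed.

Lemma lvertex_sole e : sole e -> V (esource e) = G e ** H e.
Proof.
move=> sole_e; rewrite (@lvertex_ck2 _ _ _ [:: e]) ?big_seq1// => f.
by rewrite inE; split=> [/eqP ->//|/sole_e ->].
Qed.

(** At the source of each edge the relation v = sum of e e^* has one summand, so the products e e^*
    collapse from the inside out. *)
Lemma lpath_sole v s w : walk v s w -> (forall e, e \in s -> sole e) ->
  P (v, s) ** S (v, s) = V v.
Proof.
elim: s v => [|e s IHs] v /=; first by rewrite lvertexK.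
move=> /andP[/eqP <- sw] sole_s.
rewrite lpath_cons lpath_star_cons lmulA -(lmulA (G e)) (IHs _ sw).
  by rewrite ledge_vertex -lvertex_sole //; apply: sole_s; rewrite mem_head.
by move=> f fs; apply: sole_s; rewrite in_cons fs orbT.
Qed.

Lemma lvertex_out (rfE : row_finite E) e :
  V (esource e) = \sum_(f <- out (esource e)) G f ** H f.
Proof.
apply: lvertex_ck2.
- by apply/eqP; rewrite -size_eq0 -lt0n -has_predT; apply/hasP; exists e; rewrite ?mem_out.
- exact: out_uniq.
- by move=> f; rewrite mem_out//; split=> /eqP.
Qed.

Lemma lpath_neq0 (rfE : row_finite E) v s w : walk v s w -> P (v, s) <> 0.
Proof.
move=> vsw p0; have := lpath_starK vsw; rewrite p0 lmul0r => /esym.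
exact: lvertex_neq0.
Qed.

End PathAlgebra.

Arguments lvertex_path {E K v s w}.
Arguments lpath_vertex {E K v s w}.
Arguments lvertex_path_neq {E K u v s w}.
Arguments lpath_vertex_neq {E K u v s w}.
Arguments lstar_vertex_path {E K v s w}.
Arguments lvertex_star {E K v s w}.
Arguments lpath_cat {E K v s1 s2 u w}.
Arguments lpath_star_cat {E K v s1 s2 u w}.
Arguments lpath_starK {E K v s w}.
Arguments lpath_star_prefix {E K v s1 s2 u w}.
Arguments lpath_star_mul {E K v s w v' s' w'}.
Arguments lpath_sole {E K v s w}.
Arguments lvertex_sole {E K e}.

(** * Cycles without exits and their powers *)

Section Cycles.
Variable E : digraph.
Implicit Types (c s t : seq (edge E)) (u v w : vertex E) (e f : edge E).

Definition power s k : seq (edge E) := flatten (nseq k s).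

Lemma size_power s k : size (power s k) = (k * size s)%N.
Proof. by rewrite size_flatten /shape map_nseq sumn_nseq mulnC. Qed.

Lemma walk_power v s k : walk v s v -> walk v (power s k) v.
Proof. by move=> vs; elim: k => [|k IHk] /=; rewrite ?eqxx// (walk_cat _ _ vs). Qed.

Lemma cycle_verticesP c v :
  cycle_vertices c v <-> exists2 e, e \in c & esource e = v.
Proof.
by split=> [/mapP[e ec ->]|[e ec <-]]; [exists e | exact: map_f].
Qed.

Lemma no_exitP c :
  (forall e, ~ is_exit c e) <-> (forall e, e \in c -> sole e).
Proof.
split=> [noex e ec f fe|sole_c e [f fc [ef fe]]].
  by apply: contrapT => nfe; apply: (noex f); exists e.
exact/fe/sole_c.
Qed.

Lemma composable_cycle_walk e s : cycle (@composable E) (e :: s) ->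
  walk (esource e) (e :: s) (esource e).
Proof.
move=> cyc; rewrite walkE /is_path /path_range /= eqxx andbT.
move: cyc; rewrite /= rcons_path => /andP[-> /=].
by rewrite /composable last_map.
Qed.

Lemma cycle_at_walk c u : is_cycle c -> cycle_vertices c u ->
  walk u (cycle_at c u) u.
Proof.
move=> /and3P[_ cyc _] /mapP/= [e ec ->].
rewrite /cycle_at; set i := index _ _.
have src_i : esource (nth e c i) = esource e.
  rewrite -(nth_map e (esource e)); first by rewrite nth_index ?map_f.
  by rewrite -(size_map (@esource E)) index_mem map_f.
have lt_i : (i < size c)%N by rewrite -(size_map (@esource E)) index_mem map_f.
have cyc_i : cycle (@composable E) (rot i c) by rewrite rot_cycle.
move: cyc_i; rewrite /rot (drop_nth e) // cat_cons => /composable_cycle_walk.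
by rewrite src_i.
Qed.

Lemma size_cycle_at c u : size (cycle_at c u) = size c.
Proof. exact: size_rot. Qed.

Lemma mem_cycle_at c u : cycle_at c u =i c.
Proof. exact: mem_rot. Qed.

Section NoExit.
Variables (c : seq (edge E)).
Hypotheses (cyc : is_cycle c) (sole_c : forall e, e \in c -> sole e).
Local Notation X := (cycle_vertices c).

Lemma cycle_edge e : X (esource e) -> e \in c.
Proof. by move=> /mapP[f fc ef]; rewrite (sole_c fc ef). Qed.

Lemma cycle_erange e : e \in c -> X (erange e).
Proof.
case/and3P: cyc => _ cy _ ec; apply/cycle_verticesP; exists (next c e).
  by rewrite mem_next.
by have /eqP -> := next_cycle cy ec.
Qed.

(** The only edge leaving a vertex of the cycle is the edge of the cycle there. *)
Lemma cycle_walk v s w : X v -> walk v s w -> X w /\ {subset s <= c}.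
Proof.
elim: s v => [|e s IHs] v /=; first by move=> Xv /eqP <-.
move=> Xv /andP[/eqP ev /IHs]; have ec : e \in c by apply: cycle_edge; rewrite ev.
move=> /(_ (cycle_erange ec)) [Xw sc]; split=> // f.
by rewrite inE => /orP[/eqP -> //|/sc].
Qed.

Lemma cycle_walk_eq v s1 s2 w1 w2 : X v -> walk v s1 w1 -> walk v s2 w2 ->
  size s1 = size s2 -> s1 = s2.
Proof.
move=> Xv vs1 vs2; apply: (walk_sole_eq vs1 vs2) => e es.
exact/sole_c/(cycle_walk Xv vs1).2.
Qed.

Lemma cycle_connected u v : X u -> X v ->
  exists2 s, walk u s v & (size s < size c)%N.
Proof.
move=> Xu /cycle_verticesP[e ec ev]; have uu := cycle_at_walk cyc Xu.
have [|s1 [s2 [es us1 _]]] := walk_mem uu (e := e); first by rewrite mem_cycle_at.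
exists s1; first by rewrite -ev.
by rewrite -(size_cycle_at c u) es size_cat /= addnS leq_addr.
Qed.

Lemma cycle_power_walk u k : X u -> walk u (power (cycle_at c u) k) u.
Proof. by move=> Xu; apply/walk_power/cycle_at_walk. Qed.

End NoExit.

(** This characterization by reachability shows that exitless cycles with a common vertex have the
    same vertex set. *)
Lemma cycle_vertices_walk c u : is_cycle c -> (forall e, e \in c -> sole e) ->
  cycle_vertices c u ->
  forall v, cycle_vertices c v <-> exists s, walk u s v.
Proof.
move=> cyc sole_c Xu v; split=> [Xv|[s /(cycle_walk cyc sole_c Xu)[]//]].
by have [s us _] := cycle_connected cyc Xu Xv; exists s.
Qed.

(** Strong induction on the length of [t]: a long [t] starts with a copy of [c], which splits off; a
    shorter nonempty [t] is a closed prefix of [c], which by minimality is [c] itself. *)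
Lemma flatten_walk v c t : walk v c v -> (forall e, e \in c -> sole e) ->
  c != [::] ->
  (forall s1 s2, c = s1 ++ s2 -> s1 != [::] -> walk v s1 v -> s2 = [::]) ->
  walk v t v -> (forall e, e \in t -> sole e) ->
  exists k, t = power c k.
Proof.
move=> vc sole_c c0 minc; have [k] := ubnP (size t).
elim: k t => // k IHk t /ltnSE le_tk vt sole_t.
have [->|t0] := eqVneq t [::]; first by exists 0%N.
have [lect|lttc] := leqP (size c) (size t).
  have [t' et] := walk_sole_prefix vc vt sole_c lect.
  move: vt; rewrite et (walk_cat _ _ vc) => vt'.
  have [||j ->] := IHk t' _ vt'; last by exists j.+1.
    move: le_tk; rewrite et size_cat; apply: leq_trans.
    by rewrite -add1n leq_add2r lt0n size_eq0.
  by move=> e et'; apply: sole_t; rewrite et mem_cat et' orbT.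
have [c' ec] := walk_sole_prefix vt vc sole_t (ltnW lttc).
have c'0 := minc _ _ ec t0 vt.
by exists 1%N; rewrite /power /= ec c'0 !cats0.
Qed.

(* The first return to the base point is a simple cycle, because two walks
   from a common vertex along edges without alternatives agree. *)
Lemma closed_walk_power v t : walk v t v -> t != [::] ->
  (forall e, e \in t -> sole e) ->
  exists c k, [/\ is_cycle c, cycle_vertices c v, forall e, e \in c -> sole e,
    walk v c v & t = power c k].
Proof.
move=> vt t0 sole_t.
(* The least [k] with [Q k] is the time of the first return to [v]. *)
pose Q k := (0 < k <= size t)%N && walk v (take k t) v.
have exQ : exists k, Q k.
  by exists (size t); rewrite /Q take_size vt leqnn lt0n size_eq0 t0.
case: (ex_minnP exQ) => k /andP[/andP[k0 kt] vc] mink.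
set c := take k t in vc.
have sc : size c = k by rewrite size_takel.
have ct : {subset c <= t} by exact: mem_take.
have sole_c e : e \in c -> sole e by move=> /ct/sole_t.
have c0 : c != [::] by rewrite -size_eq0 sc -lt0n.
have minc s1 s2 : c = s1 ++ s2 -> s1 != [::] -> walk v s1 v -> s2 = [::].
  move=> ec s10 vs1; have ss1 : (size s1 + size s2 = k)%N by rewrite -size_cat -ec.
  have s1E : take (size s1) t = s1.
    by rewrite -[t](cat_take_drop k) -/c ec -catA take_size_cat.
  have /mink : Q (size s1).
    rewrite /Q s1E vs1 lt0n size_eq0 s10 /= andbT.
    by apply: leq_trans kt; rewrite -ss1 leq_addr.
  by rewrite -ss1 -[X in (_ <= X)%N]addn0 leq_add2l leqn0 size_eq0 => /eqP.
have [j tE] := flatten_walk vc sole_c c0 minc vt sole_t.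
have vsrc : cycle_vertices c v.
  case: (c) c0 vc => // e s _ /= /andP[/eqP <- _].
  by apply/cycle_verticesP; exists e; rewrite ?mem_head.
exists c, j; split=> //; apply/and3P; split=> //.
  case: (c) c0 vc => // e s _; rewrite walkE /is_path /path_range /= rcons_path.
  by rewrite /composable last_map => /andP[/andP[-> /eqP ->]].
(* If positions i < i' had the same source, cutting out the edges between them would leave a closed
   walk, which is a proper prefix of [c] because edges are forced. This contradicts the first
   return. *)
apply/negP => /negP/(uniqPn v)[i [i' [ii']]]; rewrite size_map => i'c.
have [e0 _] : exists e : edge E, True by case: (c) c0 => // e; exists e.
rewrite !(nth_map e0) ?(ltn_trans ii')// => eqii'.
have := vc; rewrite -{1}(cat_take_drop i c) => /walk_catP[u vu uv].
have := vc; rewrite -{1}(cat_take_drop i' c) => /walk_catP[u' vu' u'v].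
have uE : u = u'.
  move: uv u'v; rewrite (drop_nth e0) ?(ltn_trans ii')// (drop_nth e0 i'c).
  by move=> /= /andP[/eqP <- _] /andP[/eqP <- _].
subst u'.
have [||s sE] := walk_sole_prefix u'v uv.
- by move=> e /mem_drop/sole_c.
- by rewrite !size_drop leq_sub2l// ltnW.
have cE : c = take i c ++ drop i' c ++ s by rewrite -sE cat_take_drop.
have := minc (take i c ++ drop i' c) s; rewrite -catA => /(_ cE).
rewrite (walk_cat _ _ vu) u'v => /(_ _ isT) s0.
have : s != [::].
  rewrite -size_eq0; apply/negP => /eqP s0'.
  have := congr1 size sE; rewrite size_cat s0' addn0 !size_drop => /eqP.
  by rewrite eqn_leq => /andP[]; rewrite leqNgt ltn_sub2l// (ltn_trans ii').
apply/negP; rewrite negbK; apply/eqP/s0.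
by rewrite -size_eq0 size_cat addn_eq0 !size_drop subn_eq0 [(size c <= _)%N]leqNgt i'c andbF.
Qed.

End Cycles.

(** * The central element attached to a cycle and an exponent *)

Section CycleSum.
Variables (E : digraph) (K : fieldType).
Local Notation L := (leavitt E K).
Local Notation V := (@lvertex E K).
Local Notation G := (@ledge E K).
Local Notation H := (@lghost E K).
Local Notation P := (@lpath E K).
Local Notation S := (@lpath_star E K).
Implicit Types (x y z : L) (s : seq (edge E)) (u v w : vertex E) (e f : edge E).

Lemma lpath_power v s k : walk v s v ->
  P (v, power s k.+1) = iter k (lmul (P (v, s))) (P (v, s)).
Proof.
move=> vs; elim: k => [|k IHk]; first by rewrite /power /= cats0.
by rewrite [power _ _]/= (lpath_cat vs (walk_power k.+1 vs)) IHk.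
Qed.

Lemma iter_lmulC x k : x ** iter k (lmul x) x = iter k (lmul x) x ** x.
Proof. by elim: k => //= k IHk; rewrite {1}IHk lmulA. Qed.

Lemma lstar_iter x k : lstar (iter k (lmul x) x) = iter k (lmul (lstar x)) (lstar x).
Proof. by elim: k => //= k IHk; rewrite lstarM IHk iter_lmulC. Qed.

Lemma cycle_powerN c u (m : int) :
  cycle_power K c u (- m) = lstar (cycle_power K c u m).
Proof.
case: m => [[|m]|m]; first by rewrite oppr0 lstar_vertex.
  by rewrite -[- _]/(Negz m) /= lstar_iter lstar_path.
by rewrite -[- _]/(Posz m.+1) /= lstar_iter lstar_path_star.
Qed.

Lemma cycle_power_nat c u k : is_cycle c -> cycle_vertices c u ->
  cycle_power K c u k%:Z = P (u, power (cycle_at c u) k).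
Proof.
move=> cyc Xu; case: k => [|k] //=.
by rewrite -lpath_power//; exact: cycle_at_walk.
Qed.

Definition entries (X : set (vertex E)) : set (prepath E) :=
  first_entry X `|` trivial_paths X.

Lemma walk_sources v s w : walk v s w ->
  belast v [seq erange e | e <- s] = [seq esource e | e <- s].
Proof. by elim: s v => //= e s IHs v /andP[/eqP -> /IHs ->]. Qed.

(** A trivial path is the case without edges, so one condition covers both kinds of indices. *)
Lemma entriesP X v s : entries X (v, s) <->
  [/\ is_path (v, s), X (path_range (v, s)) & forall e, e \in s -> ~ X (esource e)].
Proof.
split=> [[[/= vs _ nX Xr]|[/= Xv ->]]|[vs Xr nX]]; first 1 last.
- by split.
- have [s0|s0] := eqVneq s [::]; first by right; move: Xr; rewrite s0.
  left; split=> // w; rewrite /= (walk_sources (walkP vs)) => /mapP[e es ->].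
  exact: nX.
split=> // e es; apply: nX.
by rewrite (walk_sources (walkP vs)) map_f.
Qed.

(** No edge of an entry path starts on the cycle, so the path does not contain [c], and [cycleS]
    leaves finitely many such paths. *)
Lemma entries_finite c : cycleS c -> finite_set (entries (cycle_vertices c)).
Proof.
case=> cyc _; apply: sub_finite_set => -[v s] /entriesP[vs Xr nX]; split=> //=.
apply/negP => /infixP[s1 [s2 es]]; case/and3P: cyc => c0 _ _.
case: c c0 {Xr} nX es => // e c _ nX es; apply: (nX e).
  by rewrite es mem_cat in_cons eqxx orbT.
by apply/cycle_verticesP; exists e; rewrite ?mem_head.
Qed.

Definition entry_seq X : seq (prepath E) := fset_set (entries X).

Section InS.
Variables (c : seq (edge E)).
Hypothesis Sc : cycleS c.
Local Notation X := (cycle_vertices c).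
Local Notation A := (entry_seq X).

Let cyc : is_cycle c. Proof. by case: Sc. Qed.
Let sole_c : forall e, e \in c -> sole e.
Proof. by apply/no_exitP; case: Sc. Qed.

Lemma mem_entry_seq p : p \in A <-> entries X p.
Proof.
rewrite -[p \in A]/(p \in fset_set _) in_fset_set; last exact: entries_finite.
by split=> [/set_mem|/mem_set].
Qed.

Lemma entry_seq_uniq : uniq A. Proof. exact: fset_uniq. Qed.

Lemma entry_walk v s : (v, s) \in A -> walk v s (path_range (v, s)).
Proof. by move=> /mem_entry_seq/entriesP[vs _ _]; exact: walkP. Qed.

Lemma cycle_vertices_finite : finite_set X.
Proof. by apply: (sub_finite_set (B := [set` [seq esource e | e <- c]])). Qed.

(** The power at [u] absorbs [V u] on the left, so only the range of the path contributes;
    finiteness of both index sets turns the sum into an ordinary one. *)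
Lemma cycle_sumE (m : int) :
  cycle_sum K c m =
  \sum_(p <- A) P p ** cycle_power K c (path_range p) m ** S p.
Proof.
have finA := entries_finite Sc.
have finX := cycle_vertices_finite.
rewrite /cycle_sum -(pair_fsbig _
  (fun p u => P p ** cycle_power K c u m ** S p) finA finX) fsbig_finite//=.
apply: eq_big_seq => -[v s] /mem_entry_seq ps.
have /entriesP[/walkP vs Xr _] := ps.
rewrite (fsbigD1 (path_range (v, s)))//=.
rewrite fsbig1 ?addr0// => u [/= Xu nu].
have -> : cycle_power K c u m = V u ** cycle_power K c u m.
  have [k [->|->]] : exists k : nat, m = k \/ m = - k%:Z.
  - by case: m => k; [exists k; left | exists k.+1; right].
  - by rewrite cycle_power_nat// (lvertex_path (cycle_power_walk cyc k Xu)).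
  rewrite cycle_powerN cycle_power_nat// lstar_path.
  by rewrite (lvertex_star (cycle_power_walk cyc k Xu)).
by rewrite !lmulA (lpath_vertex_neq vs) ?lmul0l//; apply/eqP.
Qed.

Lemma cycle_sumN (m : int) : cycle_sum K c (- m) = lstar (cycle_sum K c m).
Proof.
rewrite !cycle_sumE linear_sum; apply: eq_bigr => p _.
by rewrite /= !lstarM lstar_path lstar_path_star cycle_powerN lmulA.
Qed.

Section PositivePower.
Variable m : nat.
Local Notation T u := (power (cycle_at c u) m).
Local Notation F p := (P p ** P (path_range p, T (path_range p)) ** S p).
Local Notation x := (cycle_sum K c m).

Lemma cycle_sum_natE : x = \sum_(p <- A) F p.
Proof.
rewrite cycle_sumE big_seq [RHS]big_seq; apply: eq_bigr => -[v s].
by move=> /mem_entry_seq/entriesP[_ Xr _]; rewrite cycle_power_nat.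
Qed.

Lemma lvertex_cycle_sum v : V v ** x = \sum_(p <- A | p.1 == v) F p.
Proof.
rewrite cycle_sum_natE lmul_sumr [RHS]big_mkcond; apply: eq_big_seq => -[w s] /entry_walk ws.
rewrite !lmulA /=; case: eqP => [<-|/eqP wv]; first by rewrite (lvertex_path ws).
by rewrite (lvertex_path_neq ws) ?lmul0l// eq_sym.
Qed.

Lemma cycle_sum_vertex v : x ** V v = \sum_(p <- A | p.1 == v) F p.
Proof.
rewrite cycle_sum_natE lmul_suml [RHS]big_mkcond; apply: eq_big_seq => -[w s] /entry_walk ws.
rewrite -!lmulA /= -(lstar_vertex_path ws) -lmulA lvertexM.
by case: eqP => _; rewrite ?lmul0r// (lstar_vertex_path ws).
Qed.

(** A path entering the cycle from outside does not start on it, so the only index starting at [u]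
    is the trivial path. *)
Lemma lvertex_cycle_sum_in u : X u -> V u ** x = P (u, T u).
Proof.
move=> Xu; rewrite lvertex_cycle_sum -big_filter.
have -> : [seq p <- A | p.1 == u] = [:: (u, [::])].
  apply: perm_small_eq => //; apply: uniq_perm => //.
    exact/filter_uniq/entry_seq_uniq.
  move=> [v s]; rewrite mem_filter inE; apply/andP/eqP => /=.
    move=> [/eqP -> /mem_entry_seq/entriesP[us _ nX]].
    case: s us nX => // e s /walkP /= /andP[/eqP eu _] /(_ e (mem_head _ _)).
    by rewrite eu.
  move=> [-> ->]; rewrite eqxx; split=> //; apply/mem_entry_seq/entriesP.
  by split.
rewrite big_seq1 /= -[path_range _]/u -[P (u, [::])]/(V u) -[S _]/(V u).
have uu := cycle_power_walk cyc m Xu.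
by rewrite (lvertex_path uu) (lpath_vertex uu).
Qed.

Lemma lvertex_cycle_sum_walk v : V v ** x <> 0 -> exists s u, walk v s u /\ X u.
Proof.
move=> vx0; apply: contrapT => nwalk; apply: vx0.
rewrite lvertex_cycle_sum big_seq_cond big1// => -[w s] /= /andP[/[dup] ps /entry_walk ws /eqP wv].
case: nwalk; exists s, (path_range (w, s)); rewrite -{1}wv; split=> //.
by case/mem_entry_seq/entriesP: ps.
Qed.

(** Prefixing [e] matches the entries that start at its range with those whose first edge is [e].
    This reindexes the products x e and e^* x. *)
Lemma sum_entries_edge e (f : prepath E -> L) : ~ X (esource e) ->
  (forall v s, (v, s) \in A -> ohead s != Some e -> f (v, s) = 0) ->
  \sum_(p <- A) f p =
  \sum_(p <- A | p.1 == erange e) f (esource e, e :: p.2).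
Proof.
move=> nXe f0; rewrite (bigID (fun p => ohead p.2 == Some e)) /=.
rewrite [X in _ + X]big_seq_cond [X in _ + X]big1 ?addr0; last first.
  by move=> -[v s] /= /andP[]; exact: f0.
rewrite -big_filter -[RHS]big_filter.
rewrite -(big_map (fun p : prepath E => (esource e, e :: p.2)) xpredT f).
apply: perm_big; apply: uniq_perm.
- exact/filter_uniq/entry_seq_uniq.
- rewrite map_inj_in_uniq; first exact/filter_uniq/entry_seq_uniq.
  move=> [v s] [v' s']; rewrite !mem_filter /= => /andP[/eqP -> _] /andP[/eqP -> _].
  by case=> ->.
move=> [v s]; rewrite mem_filter /=; apply/andP/mapP.
  case=> hs /mem_entry_seq/entriesP[/walkP].
  case: s hs => //= _ s /eqP[->] /andP[/eqP <- es] Xr nX.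
  exists (erange e, s) => //; rewrite mem_filter /= eqxx /=.
  apply/mem_entry_seq/entriesP; split; first exact: walk_path es.
    by rewrite (walk_range es).
  by move=> f1 f1s; apply: nX; rewrite in_cons f1s orbT.
move=> [[w s']]; rewrite mem_filter /= => /andP[/eqP -> /mem_entry_seq/entriesP].
move=> [/walkP ws Xr nX] [-> ->]; split=> //=; apply/mem_entry_seq/entriesP.
have es : walk (esource e) (e :: s') (path_range (erange e, s')).
  by rewrite /= eqxx.
split; first exact: walk_path es.
  by rewrite (walk_range es).
by move=> f1; rewrite in_cons => /orP[/eqP ->//|/nX].
Qed.

(** Both sides are paths of the same length from the same cycle vertex, hence equal. *)
Lemma power_edge e : e \in c ->
  G e ** P (erange e, T (erange e)) = P (esource e, T (esource e)) ** G e.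
Proof.
move=> ec; have Xe : X (esource e) by exact: map_f.
have Xr := cycle_erange cyc ec.
have rr := cycle_power_walk cyc m Xr; have ee := cycle_power_walk cyc m Xe.
have e1 : walk (esource e) [:: e] (erange e) by rewrite /= !eqxx.
have -> : G e = P (esource e, [:: e]) by [].
rewrite -(lpath_cat e1 rr) -(lpath_cat ee e1); congr (P (_, _)).
apply: (cycle_walk_eq cyc sole_c Xe).
- by rewrite (walk_cat _ _ e1); exact: rr.
- by rewrite (walk_cat _ _ ee); exact: e1.
- by rewrite !size_cat !size_power !size_cycle_at addnC.
Qed.

Lemma entry_edge_prefix e p : p \in A -> p.1 == erange e ->
  [/\ P (esource e, e :: p.2) = G e ** P p,
      S (esource e, e :: p.2) = S p ** H e &
      path_range (esource e, e :: p.2) = path_range p].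
Proof.
case: p => v s /= /entry_walk vs /eqP vE; subst v.
by rewrite lpath_cons lpath_star_cons.
Qed.

(** On the cycle this is [power_edge]. Off it, only entries beginning with [e] survive in x e, and
    e^* e = r(e) turns their terms into those of e x. *)
Lemma cycle_sum_edge e : x ** G e = G e ** x.
Proof.
have [Xe|nXe] := pselect (X (esource e)).
  have ec := cycle_edge sole_c Xe; have Xr := cycle_erange cyc ec.
  rewrite -{1}(lvertex_edge K e) lmulA cycle_sum_vertex -lvertex_cycle_sum.
  rewrite lvertex_cycle_sum_in// -power_edge// -lvertex_cycle_sum_in//.
  by rewrite lmulA ledge_vertex.
rewrite {1}cycle_sum_natE lmul_suml (sum_entries_edge nXe).
  rewrite -(ledge_vertex K e) -lmulA lvertex_cycle_sum lmul_sumr.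
  rewrite big_seq_cond [RHS]big_seq_cond; apply: eq_bigr => p /andP[pA pe].
  have [-> -> ->] := entry_edge_prefix pA pe; case: p pA pe => v s /entry_walk vs /= /eqP vE.
  by rewrite ledge_vertex -!lmulA lghost_edgeK -vE (lstar_vertex_path vs).
(* The other terms vanish: a trivial entry is a cycle vertex, so not the source of [e], and a
   different first edge f gives f^* e = 0. *)
move=> v s /[dup] /entry_walk vs /mem_entry_seq/entriesP[_ Xr _].
rewrite -lmulA; case: s vs Xr => [|f s] /=.
  move=> _ Xv _; have vE : v != esource e by apply/eqP => vE; rewrite vE in Xv.
  rewrite -(lvertex_edge K e) -[S _]/(V v) (lmulA (V v)) lvertexM (negPf vE).
  by rewrite lmul0l lmul0r.
move=> _ _ fe; rewrite lpath_star_cons -(lmulA _ (H f)) lghost_edge.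
case: eqP => [fe'|_]; last by rewrite !lmul0r.
by rewrite fe' eqxx in fe.
Qed.

Lemma cycle_sum_ghost e : x ** H e = H e ** x.
Proof.
have [Xe|nXe] := pselect (X (esource e)).
  have ec := cycle_edge sole_c Xe; have Xr := cycle_erange cyc ec.
  rewrite -{1}(lvertex_ghost K e) lmulA cycle_sum_vertex -lvertex_cycle_sum.
  rewrite -[in RHS](lghost_vertex K e) -[in RHS]lmulA !lvertex_cycle_sum_in//.
  (* The end vertex of the power is replaced by e e^*; [power_edge] then moves e to the left, where
     it meets e^*. *)
  rewrite -(lpath_vertex (cycle_power_walk cyc m Xe)) (lvertex_sole (sole_c ec)).
  rewrite (lmulA (P _)) -power_edge// !lmulA lghost_edgeK.
  by rewrite (lvertex_path (cycle_power_walk cyc m Xr)).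
rewrite [in RHS]cycle_sum_natE lmul_sumr (sum_entries_edge nXe).
  rewrite -(lvertex_ghost K e) lmulA cycle_sum_vertex lmul_suml.
  rewrite big_seq_cond [RHS]big_seq_cond; apply: eq_bigr => p /andP[pA pe].
  have [-> -> ->] := entry_edge_prefix pA pe; case: p pA pe => v s /entry_walk vs /= /eqP vE.
  rewrite !lmulA lvertex_ghost lghost_edgeK -vE (lvertex_path vs).
  by rewrite -!lmulA.
move=> v s /[dup] /entry_walk vs /mem_entry_seq/entriesP[_ Xr _].
rewrite !lmulA; case: s vs Xr => [|f s] /=.
  move=> _ Xv _; have vE : esource e != v by apply/eqP => vE; rewrite -vE in Xv.
  by rewrite -(lghost_vertex K e) -[P _]/(V v) -(lmulA (H e)) lvertexM (negPf vE) lmul0r !lmul0l.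
move=> _ _ fe; rewrite lpath_cons lmulA lghost_edge.
case: eqP => [fe'|_]; last by rewrite !lmul0l.
by rewrite fe' eqxx in fe.
Qed.

Lemma cycle_sum_central : lcenter x.
Proof.
apply: lcenter_generators; [|exact: cycle_sum_edge|exact: cycle_sum_ghost].
by move=> v; rewrite cycle_sum_vertex lvertex_cycle_sum.
Qed.

Lemma cycle_sum_homogeneous : lhomogeneous (m%:Z * (size c)%:Z) x.
Proof.
rewrite cycle_sum_natE big_seq; elim/big_ind: _.
- exact: linear_span0.
- by move=> y z hy hz; rewrite -[y]scale1r; exact: linear_span_comb.
move=> [v s] ps; have vs := entry_walk ps.
have Xr : X (path_range (v, s)) by case/mem_entry_seq/entriesP: ps.
have rr := cycle_power_walk cyc m Xr.
apply: linear_span_sub; exists (v, s ++ T (path_range (v, s))), (v, s); split.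
- by apply: (walk_path (w := path_range (v, s))); rewrite (walk_cat _ _ vs).
- exact: walk_path vs.
- by rewrite /= size_cat size_power size_cycle_at PoszD PoszM addrAC subrr add0r.
- by rewrite (lpath_cat vs rr).
Qed.

End PositivePower.
End InS.
End CycleSum.

(** * Homogeneous elements of nonnegative degree *)

Section Homogeneous.
Variables (E : digraph) (K : fieldType) (n : nat).
Local Notation L := (leavitt E K).
Local Notation V := (@lvertex E K).
Local Notation P := (@lpath E K).
Local Notation S := (@lpath_star E K).
Implicit Types (x y z : L) (s : seq (edge E)) (u v w : vertex E) (e f : edge E).

Lemma homogeneous_ind (Q : L -> Prop) :
  Q 0 -> (forall (a : K) x y, Q x -> Q y -> Q (a *: x + y)) ->
  (forall v p w v' q w', walk v p w -> walk v' q w' ->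
    size p = (size q + n)%N -> Q (P (v, p) ** S (v', q))) ->
  forall z, lhomogeneous n%:Z z -> Q z.
Proof.
move=> Q0 QD QP; apply: linear_span_min => // _ [[v p] [[v' q] [/walkP vp /walkP v'q npq ->]]].
apply: (QP _ _ _ _ _ _ vp v'q); apply/eqP; rewrite -eqz_nat PoszD -npq /=.
by rewrite addrC subrK.
Qed.

(** [N] bounds the lengths of the ghost parts in an expression of [z]. For longer [q], every term is
    absorbed by [p] and [q]; the remainders have equal length, so their product is a vertex or 0. *)
Lemma homogeneous_scalar z : lhomogeneous n%:Z z -> exists N : nat,
  forall v p w v' q w', walk v p w -> walk v' q w' ->
    size p = (size q + n)%N -> (N <= size q)%N ->
    exists a : K, S (v, p) ** z ** P (v', q) = a *: V w'.
Proof.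
move: z; apply: homogeneous_ind.
- by exists 0%N => *; exists 0; rewrite lmul0r lmul0l scale0r.
- move=> a x y [Nx xN] [Ny yN]; exists (maxn Nx Ny) => v p w v' q w' vp v'q npq.
  rewrite geq_max => /andP[/(xN _ _ _ _ _ _ vp v'q npq)[b xb] /(yN _ _ _ _ _ _ vp v'q npq)[d yd]].
  exists (a * b + d); rewrite lmulDr lmulDl lscaleAr lscaleAl xb yd.
  by rewrite scalerDl scalerA.
move=> v1 p1 w1 v2 q1 w2 vp1 vq1 npq1; exists (size q1) => v p w v' q w' vp vq npq le_q.
have le_p : (size p1 <= size p)%N by rewrite npq1 npq leq_add2r.
rewrite lmulA -[_ ** _ ** _ ** _]lmulA.
have [->|[p2 [pE vp2 ->]]] := lpath_star_mul (K := K) vp vp1 le_p.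
  by exists 0; rewrite lmul0l scale0r.
have -> : S (v2, q1) ** P (v', q) = lstar (S (v', q) ** P (v2, q1)).
  by rewrite lstarM lstar_path lstar_path_star.
have [->|[q2 [qE vq2 ->]]] := lpath_star_mul (K := K) vq vq1 le_q.
  by exists 0; rewrite linear0 lmul0r scale0r.
have sz2 : size p2 = size q2.
  by apply/eqP; rewrite -(eqn_add2l (size p1)) -size_cat -pE npq1 npq qE size_cat addnAC.
rewrite lstar_path_star.
have [|->|[s [sE ws ->]]] := lpath_star_mul (K := K) vp2 vq2.
- by rewrite sz2.
- by exists 0; rewrite scale0r.
have s0 : s = [::].
  by apply: size0nil; move: sz2; rewrite sE size_cat -[RHS]addn0 => /addnI.
by exists 1; rewrite s0 scale1r.
Qed.

(** The initial vertices of the terms of [z] suffice. Allowing larger lists lets those of two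
    summands be merged. *)
Lemma homogeneous_unit z : lhomogeneous n%:Z z -> exists U : seq (vertex E),
  forall U', uniq U' -> {subset U <= U'} -> \sum_(v <- U') V v ** z = z.
Proof.
move: z; apply: homogeneous_ind.
- by exists [::] => *; rewrite big1// => v _; rewrite lmul0r.
- move=> a x y [Ux xU] [Uy yU]; exists (Ux ++ Uy) => U' uU' sU'.
  rewrite -[in RHS](xU U')//; last by move=> v vU; rewrite sU'// mem_cat vU.
  rewrite -[in RHS](yU U')//; last by move=> v vU; rewrite sU'// mem_cat vU orbT.
  rewrite scaler_sumr -big_split; apply: eq_bigr => v _.
  by rewrite lmulDr lscaleAr.
move=> v p w v' q w' vp vq npq; exists [:: v] => U' uU' sU'.
rewrite (bigD1_seq v) ?sU' ?mem_head//= lmulA (lvertex_path vp) big1 ?addr0// => u uv.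
by rewrite lmulA (lvertex_path_neq vp uv) lmul0l.
Qed.

(** In positive degree every term begins with an edge. *)
Lemma homogeneous_sink z v : (0 < n)%N -> lhomogeneous n%:Z z ->
  (forall e, esource e <> v) -> V v ** z = 0.
Proof.
move=> n0 hz sink; move: z hz; apply: homogeneous_ind.
- by rewrite lmul0r.
- by move=> a x y x0 y0; rewrite lmulDr lscaleAr x0 y0 scaler0 addr0.
move=> u p w u' q w' up uq npq; rewrite lmulA (lvertex_path_neq up) ?lmul0l//.
case: p up npq => [_ /esym/eqP|e p /= /andP[/eqP <- _] _].
  by rewrite addn_eq0 => /andP[_]; rewrite eqn0Ngt n0.
by apply/eqP => /esym/sink.
Qed.

End Homogeneous.

(** * Central homogeneous elements of positive degree *)

Section Central.
Variables (E : digraph) (K : fieldType) (rfE : row_finite E) (n : nat).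
Local Notation L := (leavitt E K).
Local Notation V := (@lvertex E K).
Local Notation G := (@ledge E K).
Local Notation H := (@lghost E K).
Local Notation P := (@lpath E K).
Local Notation S := (@lpath_star E K).
Implicit Types (s t : seq (edge E)) (u v w : vertex E) (e f : edge E).
Hypothesis n0 : (0 < n)%N.
Variable z : L.
Hypotheses (zc : lcenter z) (zh : lhomogeneous n%:Z z).

Lemma central_path_conj v s w : walk v s w ->
  S (v, s) ** z ** P (v, s) = V w ** z.
Proof. by move=> vs; rewrite -lmulA zc lmulA (lpath_starK vs). Qed.

Lemma central_walk v s w : walk v s w -> V w ** z <> 0 -> V v ** z <> 0.
Proof.
move=> vs wz vz; apply: wz; rewrite -(central_path_conj vs).
by rewrite -(lstar_vertex_path vs) -(lmulA _ (V v)) vz lmul0r lmul0l.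
Qed.

(** Sinks are excluded by the positive degree. Otherwise v z is the sum of the e z e^* over the
    outgoing edges, and e z = e r(e) z. *)
Lemma central_step v : V v ** z <> 0 ->
  exists2 e, esource e = v & V (erange e) ** z <> 0.
Proof.
move=> vz; apply: contrapT => nstep; apply: (vz).
have [[e ev]|nosrc] := pselect (exists e, esource e = v); last first.
  by apply: (homogeneous_sink n0 zh) => e ev; apply: nosrc; exists e.
rewrite -ev (lvertex_out K rfE) lmul_suml big_seq big1// => f.
rewrite mem_out// => /eqP fe; rewrite -lmulA -zc lmulA.
have [rz|] := pselect (V (erange f) ** z = 0); last first.
  by move=> rz; case: nstep; exists f; rewrite // fe.
by rewrite -(ledge_vertex K f) -(lmulA (G f)) rz lmul0r lmul0l.
Qed.

Lemma central_extend v k : V v ** z <> 0 ->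
  exists s w, [/\ walk v s w, size s = k & V w ** z <> 0].
Proof.
elim: k v => [|k IHk] v vz; first by exists [::], v; rewrite /= eqxx.
have [e ev rz] := central_step vz; have [s [w [es sk wz]]] := IHk _ rz.
by exists (e :: s), w; split; rewrite //= ?ev ?eqxx ?sk.
Qed.

(** Conjugation by [s1] moves the base point and keeps the scalar. *)
Lemma central_rotate a w s1 s2 u : walk w s1 u -> walk u s2 w ->
  S (w, s1 ++ s2) ** z = a *: V w -> S (u, s2 ++ s1) ** z = a *: V u.
Proof.
move=> ws1 us2 ez.
rewrite (lpath_star_cat us2 ws1) -(lpath_star_prefix ws1 us2) -!lmulA -zc.
rewrite (lmulA (S (w, s1 ++ s2))) ez lscaleAl (lvertex_path ws1) lscaleAr.
by rewrite (lpath_starK ws1).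
Qed.

(** For another edge f at [w], conjugating the equation by f gives a r(f) on the right, while on the
    left moving [z] past f exposes the factor e^* f = 0. *)
Lemma central_sole_head a w e t : a != 0 -> walk w (e :: t) w ->
  S (w, e :: t) ** z = a *: V w -> sole e.
Proof.
move=> a0 /= /andP[/eqP ew _] ez f fe; apply/esym/eqP/negPn/negP => nef.
have: H f ** (S (w, e :: t) ** z) ** G f = a *: V (erange f).
  by rewrite ez lscaleAr lscaleAl -ew -fe lghost_vertex lghost_edgeK.
rewrite -!lmulA zc lpath_star_cons -!lmulA (lmulA (H e)).
rewrite lghost_edge (negPf nef) !(lmul0r, lmul0l) => /esym/eqP.
by rewrite scaler_eq0 (negPf a0) /= => /eqP; exact: lvertex_neq0.
Qed.

Lemma central_sole a w t : a != 0 -> walk w t w ->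
  S (w, t) ** z = a *: V w -> forall e, e \in t -> sole e.
Proof.
move=> a0 wt ez e et; have [s1 [s2 [tE ws1 es2]]] := walk_mem wt et.
move: ez; rewrite tE => /(central_rotate ws1 es2).
by apply: (central_sole_head (t := s2 ++ s1) a0); rewrite -cat_cons (walk_cat _ _ es2).
Qed.

Lemma central_exitless : exists N, forall v s w, walk v s w -> size s = N ->
  V w ** z <> 0 ->
  exists a c k, [/\ is_cycle c, (forall e, e \in c -> sole e),
    cycle_vertices c w, (k * size c)%N = n &
    V w ** z = a *: P (w, power (cycle_at c w) k)].
Proof.
have [N zN] := homogeneous_scalar zh; exists N => v s w vs sN wz.
have [t [w' [wt tn w'z]]] := central_extend n wz.
have [|||a za] := zN v (s ++ t) w' v s w _ vs; rewrite ?size_cat ?tn ?sN//.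
  by rewrite (walk_cat _ _ vs).
(* By centrality (s t)^* z s = t^* s^* s z = t^* z, which is thus a multiple of [V w]. *)
move: za; rewrite (lpath_star_cat vs wt) -!lmulA zc (lmulA (S (v, s))).
rewrite (lpath_starK vs) lmulA (lstar_vertex_path wt) => za.
have tz : S (w, t) ** z <> 0.
  by move=> tz; apply: w'z; rewrite -(central_path_conj wt) tz lmul0l.
have a0 : a != 0 by apply/eqP => a0; apply: tz; rewrite za a0 scale0r.
(* Left multiplication by [V w'] fixes t^* z, but annihilates [V w] if the vertices differ. *)
have ew' : w' = w.
  apply/eqP/negPn/negP => nw; apply: tz.
  have := congr1 (lmul (V w')) za; rewrite lmulA (lvertex_star wt) => ->.
  by rewrite lscaleAr lvertexM (negPf nw) scaler0.
subst w'; have sole_t := central_sole a0 wt za.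
have t0 : t != [::] by rewrite -size_eq0 tn -lt0n.
have [c [k [cyc cw sole_c wc tE]]] := closed_walk_power wt t0 sole_t.
exists a, c, k; split=> //; first by rewrite -size_power -tE.
have -> : power (cycle_at c w) k = t.
  rewrite tE; apply: (cycle_walk_eq cyc sole_c cw (cycle_power_walk cyc k cw) (walk_power k wc)).
  by rewrite !size_power size_cycle_at.
(* Without exits, w = t t^*, so w z = t t^* z = a t. *)
by rewrite -(lpath_sole wt sole_t) -lmulA za lscaleAr (lpath_vertex wt).
Qed.

End Central.

(** * Independence, spanning and passage to negative degrees *)

Section CenterBasis.
Variables (E : digraph) (K : fieldType) (rfE : row_finite E).
Local Notation L := (leavitt E K).
Local Notation V := (@lvertex E K).
Local Notation P := (@lpath E K).
Local Notation S := (@lpath_star E K).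
Implicit Types (x y z : L) (c s t : seq (edge E)) (u v w : vertex E) (e f : edge E).

Fixpoint walks_from M v : seq (seq (edge E)) :=
  if M is M'.+1 then
    [::] :: [seq e :: s | e <- out v, s <- walks_from M' (erange e)]
  else [::].

Lemma mem_walks_from M v s w : walk v s w -> (size s < M)%N -> s \in walks_from M v.
Proof.
elim: M v s => // M IHM v [|e s] /=; first by rewrite mem_head.
rewrite ltnS => /andP[/eqP ev es] sM; rewrite in_cons; apply/orP; right.
apply: (allpairs_f_dep (fun e s => e :: s)); last exact: IHM es sM.
by rewrite mem_out// ev.
Qed.

Lemma finite_walks (U : seq (vertex E)) M (A : set (prepath E)) :
  (forall v s, A (v, s) -> [/\ v \in U, is_path (v, s) & (size s < M)%N]) ->
  finite_set A.
Proof.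
move=> AU; pose B := [seq (v, s) | v <- U, s <- walks_from M v].
apply: (sub_finite_set (B := [set` B])) => // -[v s] /AU[vU vs sM] /=.
apply: (allpairs_f_dep (fun v s => (v, s))) => //.
exact: mem_walks_from (walkP vs) sM.
Qed.

(** A common vertex forces equal vertex sets, hence equal index sets, and on an exitless cycle paths
    of the same length from the same vertex agree. *)
Lemma cycle_sum_eq c c' (k k' : nat) u : cycleS c -> cycleS c' ->
  cycle_vertices c u -> cycle_vertices c' u ->
  (k * size c = k' * size c')%N ->
  cycle_sum K c k = cycle_sum K c' k'.
Proof.
move=> Sc Sc' Xu Xu' eqk.
have [[cyc /no_exitP sole_c _] [cyc' /no_exitP sole_c' _]] := (Sc, Sc').
have eqX : cycle_vertices c = cycle_vertices c'.
  apply/predeqP => v; rewrite (cycle_vertices_walk cyc sole_c Xu).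
  by rewrite (cycle_vertices_walk cyc' sole_c' Xu').
rewrite !cycle_sum_natE// eqX; apply: eq_big_seq => -[v s].
move=> /(mem_entry_seq Sc')/entriesP[_ Xr' _].
have Xr := Xr'; rewrite -eqX in Xr.
congr (_ ** P (_, _) ** _).
apply: (cycle_walk_eq cyc sole_c Xr (cycle_power_walk cyc k Xr) (cycle_power_walk cyc' k' Xr')).
by rewrite !size_power !size_cycle_at.
Qed.

Section Positive.
Variables (n : nat) (n0 : (0 < n)%N).

Lemma center_basisP x : center_basis E K n x <->
  exists c (k : nat), [/\ cycleS c, (k * size c)%N = n & x = cycle_sum K c k].
Proof.
split=> [[c [m [Sc mn ->]]]|[c [k [Sc kn ->]]]]; last first.
  by exists c, k; split; rewrite // -kn PoszM.
have [k mk] : exists k : nat, m = k.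
  case: m mn => k kn; first by exists k.
  have : 0 <= Negz k * (size c)%:Z by rewrite kn.
  case: (size c) kn => [|l]; last by [].
  by rewrite mulr0 => /esym/eqP; rewrite eqz_nat eqn0Ngt n0.
by exists c, k; split; rewrite -?mk //; apply/eqP; rewrite -eqz_nat PoszM -mk mn.
Qed.

Lemma center_basis_free : lin_indep (center_basis E K n).
Proof.
move=> r a ur rB sum0 b br.
have /center_basisP[c [k [Sc kn bE]]] := rB _ br.
have [cyc /no_exitP sole_c _] := Sc.
have [u Xu] : exists u, cycle_vertices c u.
  case/and3P: cyc => + _ _; case: (c) => // e s _; exists (esource e).
  by apply/cycle_verticesP; exists e; rewrite ?mem_head.
have := congr1 (lmul (V u)) sum0.
rewrite lmul_sumr (bigD1_seq b)//= [X in _ + X]big1_seq ?addr0; last first.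
  move=> b' /andP[/eqP bb' b'r]; rewrite lscaleAr.
  (* Otherwise a path leads from [u] to the cycle of b'; as [c] has no exit, both cycles share a
     vertex and, the degrees being equal, define the same element. *)
  suff -> : V u ** b' = 0 by rewrite scaler0.
  apply: contrapT => ub'.
  have /center_basisP[c' [k' [Sc' kn' b'E]]] := rB _ b'r.
  move: ub'; rewrite b'E => /(lvertex_cycle_sum_walk Sc')[s [u' [us Xu']]].
  apply: bb'; rewrite b'E bE; apply: (cycle_sum_eq (u := u')) => //.
    exact: (cycle_walk cyc sole_c Xu us).1.
  by rewrite kn kn'.
rewrite lscaleAr bE lvertex_cycle_sum_in// lmul0r => /eqP.
rewrite scaler_eq0 => /orP[/eqP ->//|/eqP p0].
by case: (lpath_neq0 rfE (cycle_power_walk cyc k Xu) p0).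
Qed.

Section Span.
Variable z : L.
Hypotheses (zc : lcenter z) (zh : lhomogeneous n%:Z z).

Lemma central_support : exists U : seq (vertex E),
  (forall v, V v ** z <> 0 -> v \in U) /\ z = \sum_(v <- U) V v ** z.
Proof.
have [U zU] := homogeneous_unit zh; exists (undup U).
have zE : z = \sum_(v <- undup U) V v ** z.
  by rewrite zU ?undup_uniq// => v; rewrite mem_undup.
split=> // v vz; apply: contrapT => /negP vU; apply: vz.
rewrite zE lmul_sumr big_seq big1// => w wU; rewrite lmulA lvertexM.
by case: eqP => [vw|_]; rewrite ?lmul0l//; rewrite vw wU in vU.
Qed.

(** Paths ending at [c] start in the finite support of [z], so bounding lengths suffices. After [N]
    edges such a path is on an exitless cycle; since it still reaches [c], it is already on [c] and
    can only run round it. *)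
Lemma central_cycleS c u : is_cycle c -> (forall e, e \in c -> sole e) ->
  cycle_vertices c u -> V u ** z <> 0 -> cycleS c.
Proof.
move=> cyc sole_c Xu uz; split=> //; first exact/no_exitP.
have [N zN] := central_exitless rfE n0 zc zh.
have [U [zU _]] := central_support.
(* [N] edges to be on the cycle, fewer than [size c] to reach the first source of [c], and [size c]
   for a full copy. *)
apply: (finite_walks (U := U) (M := N + 2 * size c)).
move=> v s [vs /= Xw ncs]; set w := path_range (v, s) in Xw.
have vsw : walk v s w := walkP vs.
have wz : V w ** z <> 0.
  have [t wt _] := cycle_connected cyc Xw Xu.
  exact: (central_walk zc wt uz).
split=> //; first exact/zU/(central_walk zc vsw wz).
rewrite ltnNge; apply: contra ncs => le_s.
have le_N : (N <= size s)%N by apply: leq_trans le_s; rewrite leq_addr.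
have [y vy yw] : exists2 y, walk v (take N s) y & walk y (drop N s) w.
  by apply: walk_catP; rewrite cat_take_drop.
have yz := central_walk zc yw wz.
have [|a [c' [k [cyc' sole_c' X'y _ _]]]] := zN _ _ _ vy _ yz.
  by rewrite size_takel.
have [X'w _] := cycle_walk cyc' sole_c' X'y yw.
have [t wt _] := cycle_connected cyc' X'w X'y.
have Xy : cycle_vertices c y := (cycle_walk cyc sole_c Xw wt).1.
(* [infix] asks for the list [c] itself and not a rotation, so the path is followed to the vertex
   where the list starts. *)
have [v0 Xv0 v0c] : exists2 v0, cycle_vertices c v0 & walk v0 c v0.
  case/and3P: cyc => + + _; case: (c) => // e l _ /composable_cycle_walk el.
  by exists (esource e) => //; apply/cycle_verticesP; exists e; rewrite ?mem_head.
have [t' yt' st'] := cycle_connected cyc Xy Xv0.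
have yt'c : walk y (t' ++ c) v0 by rewrite (walk_cat _ _ yt').
have [||l dE] := walk_sole_prefix yt'c yw.
- by move=> e /(cycle_walk cyc sole_c Xy yt'c).2/sole_c.
- rewrite size_cat size_drop leq_subRL// (leq_trans _ le_s)//.
  by rewrite leq_add2l mul2n -addnn leq_add2r ltnW.
apply/infixP; exists (take N s ++ t'), l.
by rewrite -[LHS](cat_take_drop N) dE !catA.
Qed.

End Span.

(** Induction on the size of a list holding the vertices on exitless cycles at which [z] is nonzero;
    each subtraction removes [w] from it. *)
Lemma center_basis_generates z : lcenter z -> lhomogeneous n%:Z z ->
  linear_span (center_basis E K n) z.
Proof.
pose supp z w := V w ** z <> 0 /\
  exists c, [/\ is_cycle c, forall e, e \in c -> sole e & cycle_vertices c w].
suff suppP (W : seq (vertex E)) : forall z, lcenter z -> lhomogeneous n%:Z z ->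
    (forall w, supp z w -> w \in W) -> linear_span (center_basis E K n) z.
  move=> zc zh; have [U [zU _]] := central_support zh.
  by apply: (suppP U) => // w [/zU].
have [m] := ubnP (size W); elim: m W => // m IHm W /ltnSE le_Wm {}z zc zh zW.
have [N zN] := central_exitless rfE n0 zc zh.
have [[w [wz [c0 [cyc0 sole_c0 X0w]]]]|nosupp] := pselect (exists w, supp z w); last first.
  (* A vertex with v z nonzero would start a walk of length [N] ending in such a vertex, so here z =
     0. *)
  have [U [_ ->]] := central_support zh.
  rewrite big1 ?linear_span0//; first exact: linear_span0.
  move=> v _; apply: contrapT => vz; apply: nosupp.
  have [s [w [vs sN wz]]] := central_extend rfE n0 zc zh N vz.
  have [a [c [k [cyc sole_c Xw _ _]]]] := zN _ _ _ vs sN wz.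
  by exists w; split=> //; exists c.
(* Running round [c0] often enough supplies the walk of length [N] ending at [w] that [zN]
   requires. *)
have [v [s vs sN]] : exists v, exists2 s, walk v s w & size s = N.
  have ww := cycle_power_walk cyc0 N X0w; set p := power _ N in ww.
  have szp : (N <= size p)%N.
    rewrite size_power size_cycle_at leq_pmulr// lt0n size_eq0.
    by case/and3P: cyc0.
  move: ww; rewrite -(cat_take_drop (size p - N) p) => /walk_catP[v _ vw].
  by exists v, (drop (size p - N) p) => //; rewrite size_drop subKn.
have [a [c [k [cyc sole_c Xw kn wzE]]]] := zN _ _ _ vs sN wz.
have Sc := central_cycleS zc zh cyc sole_c Xw wz.
set x := cycle_sum K c k.
have xB : center_basis E K n x by apply/center_basisP; exists c, k.
have xc : lcenter x := cycle_sum_central Sc k.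
have xh : lhomogeneous n%:Z x by rewrite -kn PoszM; exact: cycle_sum_homogeneous.
have -> : z = a *: x + ((- a) *: x + z) by rewrite addrA -scalerDl subrr scale0r add0r.
apply: linear_span_comb; first exact: linear_span_sub.
apply: (IHm [seq w' <- W | w' != w]).
- apply: leq_trans le_Wm; rewrite size_filter -(count_predC (pred1 w)).
  rewrite -[X in (X < _)%N]add0n ltn_add2r -has_count has_pred1.
  by apply: zW; split=> //; exists c0.
- exact: lcenter_comb.
- exact: linear_span_comb.
move=> w' [w'z [c' [cyc' sole_c' X'w']]].
have nw' : w' != w.
  apply: contra_notN w'z => /eqP ->.
  by rewrite lmulDr lscaleAr wzE lvertex_cycle_sum_in// scaleNr addNr.
rewrite mem_filter nw' /=; apply: zW; split; last by exists c'.
(* Subtraction adds no vertex: if x is nonzero at w', a path leads from w' to [c]. It stays on the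
   exitless cycle c', so w' lies on [c] and reaches [w], and [z] is nonzero at w'. *)
move=> w'z0; move: w'z; rewrite lmulDr lscaleAr w'z0 addr0 => w'x.
have [|u [s' [w's Xu]]] := @lvertex_cycle_sum_walk E K c Sc k w'.
  by move=> w'x0; apply: w'x; rewrite w'x0 scaler0.
have [X'u _] := cycle_walk cyc' sole_c' X'w' w's.
have [t ut _] := cycle_connected cyc' X'u X'w'.
have Xw' := (cycle_walk cyc sole_c Xu ut).1.
have [t' w't' _] := cycle_connected cyc Xw' Xw.
exact: (central_walk zc w't' wz).
Qed.

Lemma center_basis_pos :
  is_basis_of (center_basis E K n) (center_homogeneous E K n).
Proof.
split; first exact: center_basis_free.
apply/seteqP; split=> [|z [zc zh]]; last exact: center_basis_generates.
apply: linear_span_min => [|a x y [xc xh] [yc yh]|x /center_basisP].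
- by split; [move=> x; rewrite lmul0l lmul0r | exact: linear_span0].
- by split; [exact: lcenter_comb | exact: linear_span_comb].
move=> [c [k [Sc kn ->]]]; split; first exact: cycle_sum_central.
by rewrite -kn PoszM; exact: cycle_sum_homogeneous.
Qed.

End Positive.

Lemma lhomogeneous_star (n : int) x : lhomogeneous n x -> lhomogeneous (- n) (lstar x).
Proof.
move: x; apply: linear_span_min => [|a x y hx hy|].
- by rewrite linear0; exact: linear_span0.
- by rewrite linearP; exact: linear_span_comb.
move=> _ [p [q [pp pq npq ->]]]; apply: linear_span_sub; exists q, p.
by rewrite -npq opprB lstarM lstar_path lstar_path_star.
Qed.

Lemma center_homogeneous_star (n : int) :
  @lstar E K @^-1` center_homogeneous E K n = center_homogeneous E K (- n).
Proof.
apply/seteqP; split=> x /= [xc xh]; last first.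
  by split; [exact: lcenter_star | rewrite -[n]opprK; exact: lhomogeneous_star].
by rewrite -(lstarK x); split; [exact: lcenter_star | exact: lhomogeneous_star].
Qed.

Lemma center_basis_star (n : int) :
  @lstar E K @^-1` center_basis E K n = center_basis E K (- n).
Proof.
apply/seteqP; split=> x /= [c [m [Sc mn xE]]]; exists c, (- m); split=> //.
- by rewrite mulNr mn.
- by rewrite cycle_sumN// -xE lstarK.
- by rewrite mulNr mn opprK.
- by rewrite cycle_sumN// xE.
Qed.

End CenterBasis.

Theorem theorem3p24 (E : digraph) (K : fieldType) (n : int) :
  row_finite E -> n != 0 ->
  is_basis_of (center_basis E K n) (center_homogeneous E K n).
Proof.
move=> rfE; case: n => [n|n] n0; first by apply: center_basis_pos; rewrite // lt0n.
(* [Negz n] is -(n + 1), so the involution leads to the positive degree n + 1. *)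
rewrite NegzE -center_basis_star -center_homogeneous_star.
apply: (is_basis_of_preimage (f := @lstar E K)); first exact: lstarK.
exact: center_basis_pos.
Qed.
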